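(* Let $H=\sum_{J\in S}H_J$ be a $\mathsf k$-geometrically-site-local Hamiltonian on a hypercubic lattice of fixed spatial dimension with $\mathsf N_\Lambda$ sites and $\mathsf k=\mathcal O(1)$, with parameters $\mathsf N_P,\mathsf c_P$ as in the context, and let $S_p$ be a $p$-th order product formula ($p$ fixed). To achieve $\|S_p(t/r)^r-e^{-iHt}\|=\mathcal O(\varepsilon)$ it suffices to choose $$r=\mathcal O\!\Big(\mathsf N_\Lambda^{1/p}\frac{(\mathsf N_P\mathsf c_P t)^{1+1/p}}{\varepsilon^{1/p}}\Big),$$ and if $r=\Theta\big(\mathsf N_\Lambda^{1/p}(\mathsf N_P\mathsf c_P t)^{1+1/p}\varepsilon^{-1/p}\big)$ then the elementary gate count of the resulting product-formula circuit (each term implemented via a $p$-th order product formula over its Pauli decomposition) satisfies $$\chi=\mathcal O\!\Big(\mathsf N_P\frac{(\mathsf N_\Lambda\mathsf N_P\mathsf c_P t)^{1+1/p}}{\varepsilon^{1/p}}\Big).$$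
   Context: A $\mathsf k$-site-local Hamiltonian on a finite lattice $\Lambda$ ($\mathsf N_\Lambda=|\Lambda|$, each site carrying $\mathsf n_q$ qubits) is $H=\sum_{J\in S}H_J$, with $S$ a set of subsets of at most $\mathsf k$ sites, each $H_J$ Hermitian acting only on the qubits of the sites in $J$; $\mathsf N_H=|S|$. It is $\mathsf k$-geometrically-site-local if moreover $\Lambda$ is a hypercubic lattice with spacing $1$ in a fixed dimension $\mathsf d$ and each $J$ is a connected set of sites (contained in a ball of diameter $\mathsf k$); then $\mathsf N_H=\mathcal O(\mathsf N_\Lambda)$ and the number $\mathsf N_{ind}$ of terms containing any given site in a given position is $\mathcal O(1)$. Each $H_J=\sum_{i=1}^{\mathsf N_P^{(J)}}c_i^{(J)}P_i^{(J)}$ (distinct Pauli strings, nonzero coefficients); $\mathsf N_P=\max_J\mathsf N_P^{(J)}$, $\mathsf c_P=\max_{J,i}|c_i^{(J)}|$. A product formula is $S(\tau)=\prod_{\upsilon=1}^{\Upsilon}\mathcal P_\upsilon\big(\prod_\gamma e^{-i\tau a_\upsilon^{(\gamma)}H_\gamma}\big)$ with real $a_\upsilon^{(\gamma)}$ summing to $1$ over $\upsilon$, $\mathcal P_\upsilon$ fixed reorderings; order $p$ means $S(\tau)=e^{-iH\tau}+\mathcal O(\tau^{p+1})$; $r$ is the Trotter number. Cost model: exponential of a single scaled Pauli string counts as $\mathcal O(1)$ elementary gates. *)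

(* Defs.v *)
From HB Require Import structures.
From mathcomp Require Import all_boot all_order all_algebra.
From mathcomp Require Import all_classical all_reals all_analysis.
From mathcomp Require Import perm complex.

Set Implicit Arguments.
Unset Strict Implicit.
Unset Printing Implicit Defensive.

Import Order.TTheory GRing.Theory Num.Theory numFieldNormedType.Exports.
Local Open Scope ring_scope.

Section Q.
Variable R : realType.
Local Notation C := R[i].

Definition cR (x : R) : C := Complex x 0.
Definition iC : C := Complex 0 1.

Definition cabs (z : C) : R :=
  Num.sqrt (@complex.Re R z ^+ 2 + @complex.Im R z ^+ 2).

Definition Qubit (N nq : nat) := ('I_N * 'I_nq)%type.
Definition Basis (N nq : nat) := {ffun Qubit N nq -> bool}.
Definition Dim (N nq : nat) := #|{: Basis N nq}|.
Definition PauliString (N nq : nat) := {ffun Qubit N nq -> 'I_4}.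

Definition pauli1 (a : 'I_4) (x y : bool) : C :=
  match val a with
  | 0 => if x == y then 1 else 0
  | 1 => if x == y then 0 else 1
  | 2 => if x == y then 0 else (if x then iC else - iC)
  | _ => if x == y then (if x then -1 else 1) else 0
  end.

Definition pauli_mx N nq (P : PauliString N nq) : 'M[C]_(Dim N nq) :=
  \matrix_(i, j) \prod_(q : Qubit N nq)
      pauli1 (P q) ((enum_val i : Basis N nq) q) ((enum_val j : Basis N nq) q).

Definition expm n (A : 'M[C]_n) : 'M[C]_n :=
  let ps k := \sum_(l < k) (l`!%:R)^-1 *: A ^+ l in
  \matrix_(i, j) Complex (limn (fun k => @complex.Re R (ps k i j)))
                         (limn (fun k => @complex.Im R (ps k i j))).
End Q.

Section Q2.
Variable R : realType.
Local Notation C := R[i].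

Definition normv n (v : 'cV[C]_n) : R :=
  Num.sqrt (\sum_(i < n) (@cabs R (v i ord0)) ^+ 2).

Definition opnorm n (A : 'M[C]_n) : R :=
  sup [set normv (A *m v) | v in [set v : 'cV[C]_n | normv v = 1]]%classic.

Definition hermitian_mx n (A : 'M[C]_n) : Prop :=
  forall i j, A j i = conjc (A i j).

Definition evol n (tau : R) (H : 'M[C]_n) : 'M[C]_n :=
  expm ((- (iC R * cR tau)) *: H).

Definition prod_formula n (G U : nat) (a : 'I_U -> 'I_G -> R)
    (P : 'I_U -> {perm 'I_G}) (Hs : 'I_G -> 'M[C]_n) (tau : R) : 'M[C]_n :=
  \prod_(u < U) \prod_(g < G) evol (tau * a u (P u g)) (Hs (P u g)).

Definition coeffs_sum_one (G U : nat) (a : 'I_U -> 'I_G -> R) : Prop :=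
  forall g, \sum_(u < U) a u g = 1.

Definition has_order n (p : nat) (G : nat) (Hs : 'I_G -> 'M[C]_n)
    (S : R -> 'M[C]_n) : Prop :=
  exists c delta : R, 0 < delta /\
    forall tau : R, `|tau| < delta ->
      opnorm (S tau - evol tau (\sum_(g < G) Hs g)) <= c * `|tau| ^+ p.+1.

Definition term_mx N nq m (c : 'I_m -> C) (P : 'I_m -> PauliString N nq) :
    'M[C]_(Dim N nq) :=
  \sum_(i < m) c i *: pauli_mx R (P i).

Definition pauli_terms N nq m (c : 'I_m -> C) (P : 'I_m -> PauliString N nq) :
    'I_m -> 'M[C]_(Dim N nq) :=
  fun i => c i *: pauli_mx R (P i).

Definition NPmax G (m : 'I_G -> nat) : nat := (\max_(g < G) m g)%N.
Definition cPmax G (m : 'I_G -> nat) (c : forall g, 'I_(m g) -> C) : R :=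
  \big[Num.max/0]_(g < G) \big[Num.max/0]_(i < m g) @cabs R (c g i).

Definition trotter_r_scale (p N NP : nat) (cP t eps : R) : R :=
  N%:R `^ (p%:R^-1) * (NP%:R * cP * t) `^ (1 + p%:R^-1) / eps `^ (p%:R^-1).

Definition gate_scale (p N NP : nat) (cP t eps : R) : R :=
  NP%:R * (N%:R * NP%:R * cP * t) `^ (1 + p%:R^-1) / eps `^ (p%:R^-1).

(** The circuit: r repetitions of the outer formula S(t/r), in which each
    factor e^{-i tau' H_g} (tau' = (t/r) a_u^g) is implemented by the inner
    Uin-stage formula over the Pauli decomposition of H_g.  A gate
    (P, theta) stands for the Pauli rotation e^{-i theta P}. *)
Definition circuit N nq G (m : 'I_G -> nat)
    (c : forall g, 'I_(m g) -> C) (P : forall g, 'I_(m g) -> PauliString N nq)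
    U (a : 'I_U -> 'I_G -> R) (sig : 'I_U -> {perm 'I_G})
    Uin (b : forall n, 'I_Uin -> 'I_n -> R) (sigin : forall n, 'I_Uin -> {perm 'I_n})
    (t : R) (r : nat) : seq (PauliString N nq * C) :=
  let tau := t / r%:R in
  flatten (nseq r
    (flatten [seq
      (let g := sig u g0 in
       flatten [seq
         [seq (let i := sigin (m g) v i0 in
               (P g i, cR (tau * a u g * b (m g) v i) * c g i))
         | i0 <- enum 'I_(m g)]
       | v <- enum 'I_Uin])
     | u <- enum 'I_U, g0 <- enum 'I_G])).

(** lattice geometry: sites 'I_N placed injectively in Z^d *)
Definition l1dist d (x y : 'I_d -> int) : nat := (\sum_(i < d) `|x i - y i|)%N.

Definition site_connected N d (pos : 'I_N -> 'I_d -> int) (J : {set 'I_N}) : bool :=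
  [forall s in J, forall s' in J,
     connect (fun x y => [&& x \in J, y \in J & l1dist (pos x) (pos y) == 1%N]) s s'].

End Q2.

(* Main.v *)
(* For a product of exponentials S(t) = e^(t B_1) ... e^(t B_L) of skew-adjoint
   matrices, S' = D S where D is the sum of the B_j conjugated by the factors
   to their left.  Taylor-expanding these conjugations one factor at a time
   leaves, at order p, a remainder bounded by t^p times the sum of the norms of
   all (p+1)-fold nested commutators of the B_j (Childs, Su, Tran, Wiebe, Zhu),
   because the factors not yet expanded are isometries.  The order condition
   forces the Taylor coefficients of D below degree p to be those of -iH, so
   |S(t) - e^(-iHt)| <= t^(p+1) * (sum of nested commutators).  A nested
   commutator vanishes unless every new support meets the union of the previous
   ones, and a site lies in boundedly many connected sets of at most k sites;
   hence the sum is O(N (N_P c_P)^(p+1)), and r steps of length t/r give the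
   claim. *)
Require Import Defs.
From HB Require Import structures.
From mathcomp Require Import all_boot all_order all_algebra.
From mathcomp Require Import all_classical all_reals all_analysis.
From mathcomp Require Import perm complex ring lra zify.
Import Order.TTheory GRing.Theory Num.Theory numFieldNormedType.Exports.
Set Implicit Arguments.
Unset Strict Implicit.
Unset Printing Implicit Defensive.
Local Open Scope ring_scope.

(** * Operator norm *)

(** [has_order] supplies some constant and some radius that may depend on the Hamiltonian and on N,
    whereas [Cst] is fixed before either is known. The order condition is therefore used only
    qualitatively, to kill the low Taylor coefficients of the generator; the quantitative bound
    comes entirely from nested commutators. Each conjugation is expanded only up to total degree p,
    and what is left over is multiplied by isometries. Hence the bound carries no exponential factor
    and holds for every nonnegative time, with no smallness condition on t/r. All matrix analysis is
    reduced to norm inequalities, so entries matter only where [expm], an entrywise limit, is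
    related to its partial sums. *)

Section ComplexModulus.
Variable R : realType.
Implicit Types (z w : R[i]) (x : R).

Lemma cabsE z : `|z| = (cabs z)%:C%C.
Proof. by rewrite normc_def. Qed.

Lemma cabs_ge0 z : 0 <= cabs z.
Proof. exact: sqrtr_ge0. Qed.

Lemma cabsM z w : cabs (z * w) = cabs z * cabs w.
Proof.
by apply: (@complexI R); rewrite rmorphM /= -!cabsE normrM.
Qed.

Lemma cabsD z w : cabs (z + w) <= cabs z + cabs w.
Proof. by rewrite -lecR rmorphD /= -!cabsE ler_normD. Qed.

Lemma cabs_cR x : cabs (cR x) = `|x|.
Proof. by rewrite /cabs /= expr0n addr0 sqrtr_sqr. Qed.

Lemma cabsN z : cabs (- z) = cabs z.
Proof. by apply: (@complexI R); rewrite -!cabsE normrN. Qed.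

Lemma cabs0 : cabs (0 : R[i]) = 0.
Proof. by rewrite /cabs /= expr0n addr0 sqrtr0. Qed.

Lemma cabs1 : cabs (1 : R[i]) = 1.
Proof. by rewrite /cabs /= expr0n addr0 expr1n sqrtr1. Qed.

Lemma cabs_iC : cabs (iC R) = 1.
Proof. by rewrite /cabs /= expr0n add0r expr1n sqrtr1. Qed.

Lemma cabs_eq0 z : cabs z = 0 -> z = 0.
Proof. by move=> z0; apply/eqP; rewrite -normr_eq0 cabsE z0. Qed.

Lemma cabs_sqr z : cR (cabs z ^+ 2) = conjc z * z.
Proof.
case: z => u v; rewrite /cabs /= sqr_sqrtr ?addr_ge0 ?sqr_ge0//.
by apply/eqP; rewrite eq_complex /=; apply/andP; split; apply/eqP; ring.
Qed.

Lemma cabs_Re z : `|complex.Re z| <= cabs z.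
Proof.
by rewrite -sqrtr_sqr ler_wsqrtr// lerDl sqr_ge0.
Qed.

Lemma cabs_Im z : `|complex.Im z| <= cabs z.
Proof.
by rewrite -sqrtr_sqr ler_wsqrtr// lerDr sqr_ge0.
Qed.

Lemma cabs_ReIm z : cabs z <= `|complex.Re z| + `|complex.Im z|.
Proof.
case: z => u v.
rewrite [X in cabs X <= _](_ : _ = cR u + iC R * cR v); last first.
  by apply/eqP; rewrite eq_complex /=; apply/andP; split; apply/eqP; ring.
apply: le_trans (cabsD _ _) _.
by rewrite cabsM cabs_iC mul1r !cabs_cR.
Qed.

Lemma conjc_cR x : conjc (cR x) = cR x.
Proof. by rewrite /cR /= oppr0. Qed.

Lemma cRM x y : cR (x * y) = cR x * cR y.
Proof. exact: (rmorphM (real_complex R)). Qed.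

Lemma cRD x y : cR (x + y) = cR x + cR y.
Proof. exact: (rmorphD (real_complex R)). Qed.

Lemma cRN x : cR (- x) = - cR x.
Proof. exact: (rmorphN (real_complex R)). Qed.

Lemma cRB x y : cR (x - y) = cR x - cR y.
Proof. exact: (rmorphB (real_complex R)). Qed.

Lemma cRV x : cR x^-1 = (cR x)^-1.
Proof. exact: (fmorphV (real_complex R)). Qed.

Lemma cR_nat k : cR k%:R = k%:R :> R[i].
Proof. exact: (rmorph_nat (real_complex R)). Qed.

Lemma cR0 : cR 0 = 0 :> R[i]. Proof. by []. Qed.
Lemma cR1 : cR 1 = 1 :> R[i]. Proof. by []. Qed.

End ComplexModulus.

(* [opnorm] and [expm] are sealed because unification diverges when it
   unfolds them. *)
HB.lock Definition onorm (R : realType) (n : nat) (A : 'M[R[i]]_n) : R :=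
  opnorm A.
HB.lock Definition mexp (R : realType) (n : nat) (A : 'M[R[i]]_n) :
  'M[R[i]]_n := expm A.
Arguments onorm {R n} A.
Arguments mexp {R n} A.

Section OperatorNorm.
Variable R : realType.
Local Notation C := R[i].
Variable n : nat.
Implicit Types (u v : 'cV[C]_n) (A B : 'M[C]_n).

Lemma normv_ge0 v : 0 <= normv v.
Proof. exact: sqrtr_ge0. Qed.

Lemma normv_sqr v : normv v ^+ 2 = \sum_(i < n) cabs (v i ord0) ^+ 2.
Proof. by rewrite sqr_sqrtr// sumr_ge0// => i _; exact: sqr_ge0. Qed.

Lemma normv0 : normv (0 : 'cV[C]_n) = 0.
Proof.
rewrite /normv big1 ?sqrtr0// => i _; by rewrite mxE cabs0 expr0n.
Qed.

Lemma cabs_le_normv v i : cabs (v i ord0) <= normv v.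
Proof.
rewrite -ler_sqr ?nnegrE ?cabs_ge0 ?normv_ge0// normv_sqr (bigD1 i)//=.
by rewrite lerDl sumr_ge0// => j _; exact: sqr_ge0.
Qed.

Lemma normv_eq0 v : normv v = 0 -> v = 0.
Proof.
move=> v0; apply/matrixP => i j; rewrite (ord1 j) mxE; apply: cabs_eq0.
by apply: le_anti; rewrite cabs_ge0 -v0 cabs_le_normv.
Qed.

Lemma normvZ (z : C) v : normv (z *: v) = cabs z * normv v.
Proof.
rewrite /normv (eq_bigr (fun i => cabs z ^+ 2 * cabs (v i ord0) ^+ 2)).
  by rewrite -mulr_sumr sqrtrM ?sqr_ge0// sqrtr_sqr ger0_norm ?cabs_ge0.
by move=> i _; rewrite mxE cabsM exprMn.
Qed.

(* With a = |u| and b = |v|, sum the scalar inequality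
   (x + y)^2 <= (a + b) (x^2 / a + y^2 / b) over the coordinates. *)
Lemma normvD u v : normv (u + v) <= normv u + normv v.
Proof.
have [u0|u0] := eqVneq (normv u) 0.
  by rewrite (normv_eq0 u0) add0r normv0 add0r.
have [v0|v0] := eqVneq (normv v) 0.
  by rewrite (normv_eq0 v0) addr0 normv0 addr0.
have a0 : 0 < normv u by rewrite lt_neqAle eq_sym u0 normv_ge0.
have b0 : 0 < normv v by rewrite lt_neqAle eq_sym v0 normv_ge0.
set a := normv u in a0 *; set b := normv v in b0 *.
rewrite -ler_sqr ?nnegrE ?addr_ge0 ?normv_ge0//.
have -> : (a + b) ^+ 2 = (a + b) * (normv u ^+ 2 / a + normv v ^+ 2 / b).
  by rewrite -/a -/b; field; rewrite !gt_eqF.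
rewrite !normv_sqr !mulr_suml -big_split /= mulr_sumr.
apply: ler_sum => i _; rewrite mxE.
set x := cabs (u i ord0); set y := cabs (v i ord0).
apply: (@le_trans _ _ ((x + y) ^+ 2)).
  by rewrite ler_sqr ?nnegrE ?addr_ge0 ?cabs_ge0// cabsD.
rewrite -subr_ge0.
have -> : (a + b) * (x ^+ 2 / a + y ^+ 2 / b) - (x + y) ^+ 2 =
   (b * x - a * y) ^+ 2 / (a * b).
  by field; rewrite !gt_eqF.
by rewrite divr_ge0 ?sqr_ge0// mulr_ge0// ltW.
Qed.

Lemma normv_sum I (r : seq I) (F : I -> 'cV[C]_n) :
  normv (\sum_(i <- r) F i) <= \sum_(i <- r) normv (F i).
Proof.
elim/big_rec2: _ => [|i x y _ H]; first by rewrite normv0.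
by apply: le_trans (normvD _ _) _; rewrite lerD2l.
Qed.

Lemma mulmx_colE A v : A *m v = \sum_(j < n) v j ord0 *: col j A.
Proof.
apply/matrixP => i k; rewrite (ord1 k) mxE summxE; apply: eq_bigr => j _.
by rewrite !mxE mulrC.
Qed.

(** Crude, but it shows that the set defining [opnorm] is bounded above; otherwise its [sup] would
    be a default value. *)
Lemma normv_mulmx_ub A v :
  normv (A *m v) <= (\sum_(j < n) normv (col j A)) * normv v.
Proof.
rewrite mulmx_colE; apply: le_trans (normv_sum _ _) _; rewrite mulr_suml.
apply: ler_sum => j _; rewrite normvZ mulrC ler_wpM2l ?normv_ge0//.
exact: cabs_le_normv.
Qed.

Lemma normv_mulmx A v : normv (A *m v) <= onorm A * normv v.
Proof.
have [v0|v0] := eqVneq (normv v) 0.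
  by rewrite (normv_eq0 v0) mulmx0 normv0 mulr0.
have b0 : 0 < normv v by rewrite lt_neqAle eq_sym v0 normv_ge0.
have [w w1 vE] : exists2 w, normv w = 1 & v = cR (normv v) *: w.
  exists (cR (normv v)^-1 *: v); last by rewrite scalerA -cRM mulfV// scale1r.
  by rewrite normvZ cabs_cR ger0_norm ?invr_ge0 ?normv_ge0// mulVf.
rewrite {1}vE -scalemxAr normvZ cabs_cR ger0_norm ?normv_ge0// mulrC.
rewrite ler_wpM2r ?normv_ge0//.
rewrite onorm.unlock; apply: ub_le_sup; last by exists w.
exists (\sum_(j < n) normv (col j A)) => _ [x x1 <-].
by apply: le_trans (normv_mulmx_ub A x) _; rewrite x1 mulr1.
Qed.

Lemma opnorm_le A x : 0 <= x -> (forall v, normv (A *m v) <= x * normv v) ->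
  onorm A <= x.
Proof.
move=> x0 H; rewrite onorm.unlock /opnorm.
(* In dimension 0 there is no unit vector, and the supremum of the empty set is 0. *)
set S := (X in sup X); have [->|S0] := eqVneq S set0; first by rewrite sup0.
apply: ge_sup; first exact/set0P.
by move=> _ [v v1 <-]; apply: le_trans (H v) _; rewrite v1 mulr1.
Qed.

Lemma opnorm_ge0 A : 0 <= onorm A.
Proof.
pose S : set 'cV[C]_n := [set v | normv v = 1]%classic.
have [S0|/set0P [v v1]] := eqVneq S set0.
  by rewrite onorm.unlock /opnorm -/S S0 image_set0 sup0.
have := normv_mulmx A v; rewrite v1 mulr1; exact: le_trans (normv_ge0 _).
Qed.
Hint Resolve opnorm_ge0 : core.

Lemma opnormD A B : onorm (A + B) <= onorm A + onorm B.
Proof.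
apply: opnorm_le => [|v]; first exact: addr_ge0.
rewrite mulmxDl mulrDl; apply: le_trans (normvD _ _) _.
by rewrite lerD ?normv_mulmx.
Qed.

Lemma opnormM A B : onorm (A * B) <= onorm A * onorm B.
Proof.
apply: opnorm_le => [|v]; first exact: mulr_ge0.
rewrite -mulmxE -mulmxA; apply: le_trans (normv_mulmx _ _) _.
by rewrite -mulrA ler_wpM2l ?normv_mulmx.
Qed.

Lemma opnormZ (z : C) A : onorm (z *: A) <= cabs z * onorm A.
Proof.
apply: opnorm_le => [|v]; first by rewrite mulr_ge0 ?cabs_ge0.
by rewrite -scalemxAl normvZ -mulrA ler_wpM2l ?cabs_ge0 ?normv_mulmx.
Qed.

Lemma opnormZr (x : R) A : 0 <= x -> onorm (cR x *: A) <= x * onorm A.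
Proof. by move=> x0; rewrite -{2}(ger0_norm x0) -cabs_cR; exact: opnormZ. Qed.

Lemma opnorm0 : onorm (0 : 'M[C]_n) = 0.
Proof.
apply: le_anti; rewrite opnorm_ge0 andbT; apply: opnorm_le => // v.
by rewrite mul0mx normv0 mul0r.
Qed.

(** Not an equality, because of dimension 0. *)
Lemma opnorm1 : onorm (1 : 'M[C]_n) <= 1.
Proof.
by apply: opnorm_le => // v; rewrite mul1r mul1mx.
Qed.

Lemma opnormN A : onorm (- A) = onorm A.
Proof.
have H B : onorm (- B) <= onorm B.
  apply: opnorm_le => // v; rewrite mulNmx -scaleN1r normvZ cabsN cabs1 mul1r.
  exact: normv_mulmx.
apply: le_anti; apply/andP; split; first exact: H.
by have := H (- A); rewrite (opprK A).
Qed.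

Lemma opnormB A B : onorm (A - B) <= onorm A + onorm B.
Proof. by rewrite -(opnormN B); exact: opnormD. Qed.

Lemma opnorm_distC A B : onorm (A - B) = onorm (B - A).
Proof. by rewrite -opprB opnormN. Qed.

Lemma opnorm_tri A B D : onorm (A - D) <= onorm (A - B) + onorm (B - D).
Proof. by rewrite -[A - D](subrKA B); exact: opnormD. Qed.

Lemma opnorm_sum I (r : seq I) (P : pred I) (F : I -> 'M[C]_n) :
  onorm (\sum_(i <- r | P i) F i) <= \sum_(i <- r | P i) onorm (F i).
Proof.
elim/big_rec2: _ => [|i x y _ H]; first by rewrite opnorm0.
by apply: le_trans (opnormD _ _) _; rewrite lerD2l.
Qed.

Lemma opnormX A k : onorm (A ^+ k) <= onorm A ^+ k.
Proof.
elim: k => [|k IH]; first by rewrite !expr0 opnorm1.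
by rewrite !exprS; apply: le_trans (opnormM _ _) _; rewrite ler_wpM2l.
Qed.

Lemma opnormM1 A B : onorm A <= 1 -> onorm (A * B) <= onorm B.
Proof.
by move=> A1; apply: le_trans (opnormM _ _) _; rewrite ler_piMl.
Qed.

Lemma opnorm1M A B : onorm B <= 1 -> onorm (A * B) <= onorm A.
Proof.
by move=> A1; apply: le_trans (opnormM _ _) _; rewrite ler_piMr.
Qed.

Lemma cabs_le_opnorm A i j : cabs (A i j) <= onorm A.
Proof.
have := normv_mulmx A (delta_mx j ord0); rewrite -colE.
have -> : normv (delta_mx j ord0 : 'cV[C]_n) = 1.
  rewrite /normv (bigD1 j)//= big1 ?addr0.
    by rewrite mxE !eqxx cabs1 expr1n sqrtr1.
  by move=> i0 ij; rewrite mxE (negbTE ij) cabs0 expr0n.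
rewrite mulr1; apply: le_trans.
by apply: le_trans (cabs_le_normv _ i); rewrite mxE.
Qed.

Lemma opnorm_eq0 A : onorm A <= 0 -> A = 0.
Proof.
move=> A0; apply/matrixP => i j; rewrite mxE; apply: cabs_eq0.
apply: le_anti; rewrite cabs_ge0 andbT; apply: le_trans A0.
exact: cabs_le_opnorm.
Qed.

(** Turns entrywise convergence, in which [expm] is defined, into convergence in norm. *)
Lemma opnorm_le_entries A : onorm A <= \sum_(i < n) \sum_(j < n) cabs (A i j).
Proof.
rewrite {1}(matrix_sum_delta A).
apply: le_trans (opnorm_sum _ _ _) _; apply: ler_sum => i _.
apply: le_trans (opnorm_sum _ _ _) _; apply: ler_sum => j _.
apply: le_trans (opnormZ _ _) _.
rewrite ler_piMr ?cabs_ge0//; apply: opnorm_le => // v; rewrite mul1r.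
have -> : delta_mx i j *m v = v j ord0 *: delta_mx i ord0.
  apply/matrixP => x y; rewrite (ord1 y) !mxE (bigD1 j)//= big1.
    by rewrite !mxE !eqxx !andbT addr0 mulrC.
  by move=> z zj; rewrite mxE (negbTE zj) andbF mul0r.
rewrite normvZ; apply: le_trans (cabs_le_normv v j).
rewrite ler_piMr ?cabs_ge0//.
rewrite /normv (bigD1 i)//= big1 ?addr0.
  by rewrite mxE !eqxx cabs1 expr1n sqrtr1.
by move=> i0 ij; rewrite mxE (negbTE ij) cabs0 expr0n.
Qed.

Definition ctrans A : 'M[C]_n := map_mx conjc A^T.

Lemma ctransE A i j : ctrans A i j = conjc (A j i).
Proof. by rewrite !mxE. Qed.

Lemma ctransD A B : ctrans (A + B) = ctrans A + ctrans B.
Proof. by apply/matrixP => i j; rewrite !mxE rmorphD. Qed.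

Lemma ctransN A : ctrans (- A) = - ctrans A.
Proof. by apply/matrixP => i j; rewrite !mxE rmorphN. Qed.

Lemma ctransM A B : ctrans (A * B) = ctrans B * ctrans A.
Proof.
apply/matrixP => i j; rewrite !mxE rmorph_sum; apply: eq_bigr => k _.
by rewrite !mxE rmorphM mulrC.
Qed.

Lemma ctrans0 : ctrans 0 = 0.
Proof. by apply/matrixP => i j; rewrite ctransE !mxE rmorph0. Qed.

Lemma ctrans1 : ctrans 1 = 1.
Proof.
apply/matrixP => i j; rewrite !mxE eq_sym.
by case: (i == j); rewrite ?rmorph1 ?rmorph0.
Qed.

Lemma ctransZ (z : C) A : ctrans (z *: A) = conjc z *: ctrans A.
Proof. by apply/matrixP => i j; rewrite !mxE rmorphM. Qed.

Lemma ctransX A k : ctrans (A ^+ k) = ctrans A ^+ k.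
Proof.
elim: k => [|k IH]; first by rewrite !expr0 ctrans1.
by rewrite exprS ctransM IH exprSr.
Qed.

(** The squared norm of A v is v* A* A v = v* v. *)
Lemma isometry_opnorm A : ctrans A * A = 1 -> onorm A <= 1.
Proof.
move=> AA; apply: opnorm_le => // v; rewrite mul1r.
rewrite -ler_sqr ?nnegrE ?normv_ge0// !normv_sqr.
have K (w : 'cV[C]_n) : cR (\sum_(i < n) (cabs (w i ord0) ^+ 2)) =
    ((map_mx conjc w^T) *m w) ord0 ord0.
  transitivity (\sum_(i < n) cR (cabs (w i ord0) ^+ 2)).
    exact: (rmorph_sum (real_complex R)).
  by rewrite mxE; apply: eq_bigr => i _; rewrite !mxE -cabs_sqr.
rewrite -lecR [X in X <= _]K [X in _ <= X]K.
rewrite trmx_mul map_mxM mulmxA -(mulmxA _ _ A).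
have -> : map_mx conjc A^T *m A = 1%:M by exact: AA.
by rewrite mulmx1.
Qed.

End OperatorNorm.
#[global] Hint Extern 0 (is_true (0 <= onorm _)) => exact: opnorm_ge0 : core.
#[global] Hint Extern 0 (is_true (0 <= cabs _)) => exact: cabs_ge0 : core.

(** * Matrix exponential *)

(** Diagonal against row summation over the triangle i + j < k. It serves Cauchy products of
    exponentials and, later, the truncated expansion of the generator. *)
Lemma sum_triangle (V : nmodType) (f : nat -> nat -> V) k :
  \sum_(l < k) \sum_(i < l.+1) f i (l - i)%N =
  \sum_(i < k) \sum_(j < k - i) f i j.
Proof.
elim: k => [|k IH]; first by rewrite !big_ord0.
rewrite big_ord_recr IH /= [RHS]big_ord_recr /= subSnn big_ord1.
rewrite big_ord_recr /= subnn addrA -big_split /=; congr (_ + _).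
apply: eq_bigr => i _; rewrite subSn 1?ltnW// big_ord_recr /=.
by [].
Qed.

Section RealExpSum.
Local Open Scope classical_set_scope.
Local Open Scope ring_scope.
Variable R : realType.
Implicit Types a b : R.

Lemma le_cvgn a b (f : nat -> R) :
  f @ \oo --> b -> (\forall k \near \oo, a <= f k) -> a <= b.
Proof. by move=> fb; apply: (@ler_cvg_to _ _ _ _ (fun=> a) f) => //; exact: cvg_cst. Qed.

(** Shaped like [expm_psum], which it majorizes term by term when [a] is the norm of the matrix. *)
Definition rexp_psum a k : R := \sum_(l < k) (l`!%:R)^-1 * a ^+ l.

Lemma rexp_psum_series a : rexp_psum a = series (exp_coeff a).
Proof.
apply/funext => k; rewrite /rexp_psum /series /= big_mkord.
by apply: eq_bigr => i _; rewrite mulrC.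
Qed.

Lemma rexp_psum_cvg a : rexp_psum a @ \oo --> expR a.
Proof.
rewrite rexp_psum_series; exact: is_cvg_series_exp_coeff.
Qed.

Lemma rexp_psum_le a k : 0 <= a -> rexp_psum a k <= expR a.
Proof.
move=> a0; rewrite /expR -rexp_psum_series.
apply: nondecreasing_cvgn_le; last first.
  by rewrite rexp_psum_series; exact: is_cvg_series_exp_coeff.
rewrite rexp_psum_series; apply: nondecreasing_series => i _ _ /=.
by rewrite divr_ge0// exprn_ge0.
Qed.

Lemma exp_binomial_coef (T : numFieldType) l i : (i < l.+1)%N ->
  (l`!%:R)^-1 * 'C(l, i)%:R = (i`!%:R)^-1 * ((l - i)`!%:R)^-1 :> T.
Proof.
move=> il; have [f1 f2 f3] : [/\ l`!%:R != 0 :> T, i`!%:R != 0 :> T &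
    (l - i)`!%:R != 0 :> T].
  by rewrite !pnatr_eq0 -!lt0n !fact_gt0.
have : 'C(l, i)%:R * (i`!%:R * (l - i)`!%:R) = l`!%:R :> T.
  by rewrite -!natrM bin_fact.
by move=> <-; field; rewrite f2 f3 pnatr_eq0 -lt0n bin_gt0 -ltnS il.
Qed.

Lemma rexp_psumD b a k :
  rexp_psum (b + a) k =
  \sum_(i < k) rexp_psum b (k - i) * ((i`!%:R)^-1 * a ^+ i).
Proof.
rewrite -[LHS]/(\sum_(l < k) (l`!%:R)^-1 * (b + a) ^+ l).
under eq_bigr => l _ do rewrite exprDn mulr_sumr.
pose f i j := (j`!%:R)^-1 * b ^+ j * ((i`!%:R)^-1 * a ^+ i).
transitivity (\sum_(l < k) \sum_(i < l.+1) f i (l - i)%N).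
  apply: eq_bigr => l _; apply: eq_bigr => i _; rewrite /f.
  rewrite -[_ *+ 'C(_, _)]mulr_natr [_ * 'C(_, _)%:R]mulrC [LHS]mulrA.
  by rewrite exp_binomial_coef//; ring.
rewrite sum_triangle; apply: eq_bigr => i _.
by rewrite /rexp_psum mulr_suml.
Qed.

End RealExpSum.

Section MatrixExp.
Local Open Scope classical_set_scope.
Local Open Scope ring_scope.
Variable R : realType.
Local Notation C := R[i].
Variable n : nat.
Implicit Types (A B X : 'M[C]_n) (v : 'cV[C]_n).

Definition expm_psum A k : 'M[C]_n := \sum_(l < k) (l`!%:R)^-1 *: A ^+ l.

Lemma opnorm_expm_term A l :
  onorm ((l`!%:R)^-1 *: A ^+ l) <= (l`!%:R)^-1 * onorm A ^+ l.
Proof.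
rewrite -cR_nat -cRV; apply: le_trans (opnormZr _ _) _ => //.
by rewrite ler_wpM2l ?invr_ge0// opnormX.
Qed.

Lemma expm_psum_diff A k m : (m <= k)%N ->
  onorm (expm_psum A k - expm_psum A m) <=
  rexp_psum (onorm A) k - rexp_psum (onorm A) m.
Proof.
move=> mk; rewrite /expm_psum /rexp_psum.
rewrite -!(big_mkord xpredT (fun l => (l`!%:R)^-1 *: A ^+ l)).
rewrite -!(big_mkord xpredT (fun l => (l`!%:R)^-1 * onorm A ^+ l)).
rewrite (@big_cat_nat _ _ _ m)//= addrAC subrr add0r.
rewrite [X in _ <= X - _](@big_cat_nat _ _ _ m)//=.
rewrite [X in _ <= X]addrAC subrr add0r.
apply: le_trans (opnorm_sum _ _ _) _; apply: ler_sum => i _.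
exact: opnorm_expm_term.
Qed.

Lemma expm_psum_mul B A k :
  expm_psum B k * expm_psum A k =
  \sum_(i < k) expm_psum B k * ((i`!%:R)^-1 *: A ^+ i).
Proof. by rewrite mulr_sumr. Qed.

Lemma expm_psumD B A k : GRing.comm B A ->
  expm_psum (B + A) k =
  \sum_(i < k) expm_psum B (k - i) * ((i`!%:R)^-1 *: A ^+ i).
Proof.
move=> BA.
rewrite -[LHS]/(\sum_(l < k) (l`!%:R)^-1 *: (B + A) ^+ l).
pose f i j := ((j`!%:R)^-1 *: B ^+ j) * ((i`!%:R)^-1 *: A ^+ i).
transitivity (\sum_(l < k) \sum_(i < l.+1) f i (l - i)%N).
  apply: eq_bigr => l _; rewrite exprDn_comm// scaler_sumr.
  apply: eq_bigr => i _; rewrite /f.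
  rewrite -(scaler_nat (R := C) 'C(l, i)) scalerA exp_binomial_coef//.
  by rewrite -!mulmxE -scalemxAl -scalemxAr scalerA mulrC.
rewrite sum_triangle; apply: eq_bigr => i _.
by rewrite /expm_psum mulr_suml.
Qed.

(** [expm] takes [limn] of real and imaginary parts, which means something only once these converge;
    they do by comparison with the exponential series of the norm. *)
Lemma expm_psum_Re_cvg A i j :
  (fun k => complex.Re (expm_psum A k i j)) @ \oo --> complex.Re (mexp A i j).
Proof.
rewrite mexp.unlock mxE /=.
suff : cvgn (fun k => complex.Re (expm_psum A k i j)) by [].
pose u l := complex.Re (((l`!%:R)^-1 *: A ^+ l : 'M[C]_n) i j).
rewrite (_ : (fun _ => _) = series u); last first.
  apply/funext => k; rewrite /series /= big_mkord summxE.
  exact: (raddf_sum (@complex.Re R : Rcomplex R -> R)).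
apply: normed_cvg; apply: (@series_le_cvg _ _ (exp_coeff (onorm A))) => //.
- by move=> k; exact: normr_ge0.
- by move=> k; rewrite /= divr_ge0// exprn_ge0.
- move=> k /=; apply: le_trans (cabs_Re _) _.
  apply: le_trans (cabs_le_opnorm _ _ _) _.
  by apply: le_trans (opnorm_expm_term _ _) _; rewrite mulrC.
- exact: is_cvg_series_exp_coeff.
Qed.

Lemma expm_psum_Im_cvg A i j :
  (fun k => complex.Im (expm_psum A k i j)) @ \oo --> complex.Im (mexp A i j).
Proof.
rewrite mexp.unlock mxE /=.
suff : cvgn (fun k => complex.Im (expm_psum A k i j)) by [].
pose u l := complex.Im (((l`!%:R)^-1 *: A ^+ l : 'M[C]_n) i j).
rewrite (_ : (fun _ => _) = series u); last first.
  apply/funext => k; rewrite /series /= big_mkord summxE.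
  exact: (raddf_sum (@complex.Im R : Rcomplex R -> R)).
apply: normed_cvg; apply: (@series_le_cvg _ _ (exp_coeff (onorm A))) => //.
- by move=> k; exact: normr_ge0.
- by move=> k; rewrite /= divr_ge0// exprn_ge0.
- move=> k /=; apply: le_trans (cabs_Im _) _.
  apply: le_trans (cabs_le_opnorm _ _ _) _.
  by apply: le_trans (opnorm_expm_term _ _) _; rewrite mulrC.
- exact: is_cvg_series_exp_coeff.
Qed.

Lemma cvg_sum_ord m (f : 'I_m -> nat -> R) :
  (forall i, f i @ \oo --> 0) -> (fun k => \sum_(i < m) f i k) @ \oo --> 0.
Proof.
elim: m f => [|m IH] f H.
  by under eq_fun do rewrite big_ord0; exact: cvg_cst.
have -> : (fun k => \sum_(i < m.+1) f i k) =
    (fun k => \sum_(i < m) f (widen_ord (leqnSn m) i) k) \+ f ord_max.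
  by apply/funext => k; rewrite big_ord_recr.
have := cvgD (IH (fun i => f (widen_ord (leqnSn m) i)) (fun i => H _)) (H ord_max).
by rewrite addr0; apply.
Qed.

Lemma expm_psum_cvg A :
  (fun k => onorm (mexp A - expm_psum A k)) @ \oo --> 0.
Proof.
apply: (@squeeze_cvgr _ _ _ _ (fun=> 0) (fun k => \sum_(i < n) \sum_(j < n)
    (`|complex.Re (mexp A i j) - complex.Re (expm_psum A k i j)| +
     `|complex.Im (mexp A i j) - complex.Im (expm_psum A k i j)|))).
- near=> k; rewrite opnorm_ge0 /=; apply: le_trans (opnorm_le_entries _) _.
  apply: ler_sum => i _; apply: ler_sum => j _.
  apply: le_trans (cabs_ReIm _) _.
  have -> : (mexp A - expm_psum A k) i j = mexp A i j - expm_psum A k i j.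
    by rewrite [LHS]mxE [X in _ + X]mxE.
  by case: (mexp A i j) => ? ?; case: (expm_psum A k i j) => ? ?.
- exact: cvg_cst.
- apply: cvg_sum_ord => i; apply: cvg_sum_ord => j.
  have dist0 (f : nat -> R) l : f @ \oo --> l ->
      (fun k => `|l - f k|) @ \oo --> 0.
    move=> fl; have := cvg_norm (cvgB (cvg_cst l) fl).
    by rewrite subrr normr0; apply.
  rewrite -(addr0 0); apply: cvgD; apply: dist0.
    exact: expm_psum_Re_cvg.
  exact: expm_psum_Im_cvg.
Unshelve. all: by end_near. Qed.

Lemma opnorm_expm_le A : onorm (mexp A) <= expR (onorm A).
Proof.
apply: (@le_cvgn _ _ _ (fun k => onorm (mexp A - expm_psum A k) + expR (onorm A))).
- have := cvgD (expm_psum_cvg A) (cvg_cst (expR (onorm A))).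
  by rewrite add0r; apply.
near=> k; rewrite -{1}[mexp A](subrK (expm_psum A k)).
apply: le_trans (opnormD _ _) _; rewrite lerD2l.
apply: le_trans (opnorm_sum _ _ _) _.
apply: le_trans (rexp_psum_le k (opnorm_ge0 A)).
by apply: ler_sum => i _; exact: opnorm_expm_term.
Unshelve. all: by end_near. Qed.

(** The product of the partial sums differs from the partial sum at B + A by the terms with i + j >=
    k. Their norm is at most the same expression in the scalars a and b, which tends to e^b e^a -
    e^(b+a) = 0. *)
Lemma expmD B A : GRing.comm B A -> mexp (B + A) = mexp B * mexp A.
Proof.
move=> BA; apply/eqP; rewrite -subr_eq0; apply/eqP; apply: opnorm_eq0.
set a := onorm A; set b := onorm B.
pose e X k := onorm (mexp X - expm_psum X k).
apply: (@le_cvgn _ _ _ (fun k => e (B + A) k +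
    (rexp_psum b k * rexp_psum a k - rexp_psum (b + a) k) +
    (e B k * expR a + expR b * e A k))).
- have -> : 0 = 0 + (expR b * expR a - expR (b + a)) + (0 * expR a + expR b * 0).
    by rewrite expRD subrr mul0r mulr0 !addr0.
  have eX X : e X @ \oo --> 0 := @expm_psum_cvg X.
  have rX x : rexp_psum x @ \oo --> expR x := @rexp_psum_cvg R x.
  have c1 := cvgD (eX (B + A)) (cvgB (cvgM (rX b) (rX a)) (rX (b + a))).
  have c2 := cvgD (cvgM (eX B) (cvg_cst (expR a))) (cvgM (cvg_cst (expR b)) (eX A)).
  exact: (cvgD (c1 _ _ _) (c2 _ _ _ _ _)).
near=> k; rewrite /e.
apply: le_trans (opnorm_tri _ (expm_psum (B + A) k) _) _.
rewrite -addrA lerD2l.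
apply: le_trans (opnorm_tri _ (expm_psum B k * expm_psum A k) _) _.
apply: lerD.
  rewrite opnorm_distC expm_psumD// expm_psum_mul -sumrB.
  rewrite rexp_psumD /rexp_psum mulr_sumr -sumrB.
  apply: le_trans (opnorm_sum _ _ _) _; apply: ler_sum => i _.
  rewrite -mulrBl -[X in _ <= X]mulrBl; apply: le_trans (opnormM _ _) _.
  apply: ler_pM => //; last exact: opnorm_expm_term.
  by apply: expm_psum_diff; exact: leq_subr.
rewrite opnorm_distC.
have -> : mexp B * mexp A - expm_psum B k * expm_psum A k =
    (mexp B - expm_psum B k) * mexp A + expm_psum B k * (mexp A - expm_psum A k).
  by rewrite mulrBl mulrBr subrKA.
apply: le_trans (opnormD _ _) _; apply: lerD; apply: le_trans (opnormM _ _) _.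
  by rewrite ler_wpM2l ?opnorm_expm_le.
rewrite ler_wpM2r//.
apply: le_trans (opnorm_sum _ _ _) _.
apply: le_trans (rexp_psum_le k (opnorm_ge0 B)).
by apply: ler_sum => i _; exact: opnorm_expm_term.
Unshelve. all: by end_near. Qed.

Lemma expm0 : mexp (0 : 'M[C]_n) = 1.
Proof.
apply/eqP; rewrite -subr_eq0; apply/eqP; apply: opnorm_eq0.
apply: (@le_cvgn _ _ _ (fun k => onorm (mexp 0 - expm_psum 0 k))).
- exact: expm_psum_cvg.
near=> k.
suff -> : expm_psum 0 k = 1 by [].
have k0 : (0 < k)%N by near: k; exact: nbhs_infty_gt.
rewrite -(prednK k0) /expm_psum big_ord_recl big1 ?addr0.
  by rewrite expr0 fact0 invr1 scale1r.
by move=> i _; rewrite expr0n /= scaler0.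
Unshelve. all: by end_near. Qed.

(** Source of the O(h^2) error that makes flows differentiable in the sense of [qderiv]. Dropping
    two terms leaves coefficients 1/(i+2)!, which are at most 1/i!. *)
Lemma opnorm_expm_sub A :
  onorm (mexp A - 1 - A) <= onorm A ^+ 2 * expR (onorm A).
Proof.
apply: (@le_cvgn _ _ _ (fun k =>
  onorm (mexp A - expm_psum A k) + onorm A ^+ 2 * expR (onorm A))).
- have := cvgD (expm_psum_cvg A) (cvg_cst (onorm A ^+ 2 * expR (onorm A))).
  by rewrite add0r; apply.
near=> k.
rewrite -addrA -opprD.
apply: le_trans (opnorm_tri _ (expm_psum A k) _) _; rewrite lerD2l.
have k0 : (1 < k)%N by near: k; exact: nbhs_infty_gt.
rewrite -(subnK k0) addn2 /expm_psum big_ord_recl big_ord_recl /=.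
rewrite expr0 fact0 invr1 scale1r /bump /= addn0 scale1r expr1.
rewrite addrA [X in X - _]addrC addrK.
apply: le_trans (opnorm_sum _ _ _) _.
apply: (@le_trans _ _ (onorm A ^+ 2 * rexp_psum (onorm A) (k - 2))).
  rewrite /rexp_psum mulr_sumr; apply: ler_sum => i _.
  apply: le_trans (opnorm_expm_term _ _) _.
  rewrite !add1n -[i.+2]add2n exprD mulrCA ler_wpM2l ?exprn_ge0//.
  rewrite ler_wpM2r ?exprn_ge0// lef_pV2 ?posrE ?ltr0n ?fact_gt0//.
  by rewrite ler_nat; apply: leq_fact; rewrite leq_addl.
by rewrite ler_wpM2l ?exprn_ge0// rexp_psum_le.
Unshelve. all: by end_near. Qed.

Lemma ctrans_expm_psum A k : ctrans (expm_psum A k) = expm_psum (ctrans A) k.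
Proof.
rewrite /expm_psum (big_morph (@ctrans R n) (@ctransD R n) (ctrans0 R n)).
apply: eq_bigr => l _; rewrite ctransZ ctransX; congr (_ *: _).
by rewrite -cR_nat -cRV conjc_cR.
Qed.

Lemma ctrans_expm A : ctrans (mexp A) = mexp (ctrans A).
Proof.
apply/matrixP => i j; rewrite ctransE.
have H k : expm_psum (ctrans A) k i j = conjc (expm_psum A k j i).
  by rewrite -ctransE ctrans_expm_psum.
have re : complex.Re (mexp (ctrans A) i j) = complex.Re (mexp A j i).
  have := @expm_psum_Re_cvg (ctrans A) i j; under eq_fun do rewrite H.
  move=> /cvg_lim <- //; have := @expm_psum_Re_cvg A j i.
  move=> /cvg_lim <- //; congr (limn _); apply/funext => k.
  by case: (expm_psum A k j i).
have im : complex.Im (mexp (ctrans A) i j) = - complex.Im (mexp A j i).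
  have := @expm_psum_Im_cvg (ctrans A) i j; under eq_fun do rewrite H.
  move=> /cvg_lim <- //; have /(_ _) := cvgN (@expm_psum_Im_cvg A j i).
  move=> /cvg_lim <- //; congr (limn _); apply/funext => k /=.
  by rewrite opprfctE; case: (expm_psum A k j i).
have conjE (z w : C) : complex.Re z = complex.Re w ->
    complex.Im z = - complex.Im w -> conjc w = z.
  by case: z w => [? ?] [? ?] /= -> ->.
exact: (conjE _ _ re im).
Qed.

End MatrixExp.

(** * Difference calculus for matrix-valued functions *)

(** Bookkeeping of the Leibniz rule [qdiffM]: x1, x2, x3 stand for F(t+h)G(t+h), F(t)G(t),
    F(t)G(t+h), and y1, y2, y3 for h F'(t)G(t), h F(t)G'(t), h F'(t)G(t+h). *)
Lemma sub_telescope (V : zmodType) (x1 x2 x3 y1 y2 y3 : V) :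
  x1 - x2 - (y1 + y2) = (x1 - x3 - y3) + (y3 - y1) + (x3 - x2 - y2).
Proof.
rewrite [_ + (y3 - y1)]addrA subrK [x1 - x3 - y1]addrAC -[x3 - x2 - y2]addrA.
by rewrite [RHS]addrA subrK [RHS]addrACA opprD.
Qed.

Section QuasiDerivative.
Variable R : realType.
Local Notation C := R[i].
Variable n : nat.
Implicit Types (X Y : 'M[C]_n) (F G : R -> 'M[C]_n) (T t h : R).

Definition bdd_on T F := exists2 c : R, 0 <= c &
  forall t, 0 <= t <= T -> onorm (F t) <= c.

(* A first-order expansion with uniform O(h^2) error: it yields the Leibniz
   rule and the mean value inequality without differentiating matrix entries. *)
Definition qderiv T F F' := exists2 c : R, 0 <= c &
  forall t h, 0 <= t -> 0 <= h -> t + h <= T ->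
    onorm (F (t + h) - F t - cR h *: F' t) <= c * h ^+ 2.

(** The bounds travel with the expansion because the error constant of a product is built from
    them. *)
Definition qdiff T F F' := [/\ qderiv T F F', bdd_on T F & bdd_on T F'].

(** Cut [0, T] into k equal steps: the first-order terms add up to at most M T, and the errors to k
    c (T/k)^2 = c T^2 / k, which is below any e > 0 for large k. *)
Lemma qderiv_mvt T F F' M : 0 <= T -> qderiv T F F' ->
  (forall t, 0 <= t <= T -> onorm (F' t) <= M) ->
  onorm (F T - F 0) <= M * T.
Proof.
move=> T0 [c c0 H] HM; apply/ler_addgt0Pr => e e0.
set k := Num.bound (c * T ^+ 2 / e).
have ck : c * T ^+ 2 / e < k%:R.
  by apply: archi_boundP; rewrite divr_ge0 ?mulr_ge0 ?exprn_ge0// ltW.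
have k0 : 0 < k%:R :> R.
  by apply: le_lt_trans ck; rewrite divr_ge0 ?mulr_ge0 ?exprn_ge0// ltW.
pose h := T / k%:R.
have h0 : 0 <= h by rewrite divr_ge0// ltW.
have step i : (i <= k)%N ->
    onorm (F (i%:R * h) - F 0) <= i%:R * (M * h + c * h ^+ 2).
  elim: i => [|i IH] ik; first by rewrite !mul0r subrr opnorm0.
  have ih : 0 <= i%:R * h by rewrite mulr_ge0.
  have ihT : i.+1%:R * h <= T.
    by rewrite /h mulrA ler_pdivrMr// [i.+1%:R * _]mulrC ler_wpM2l// ler_nat.
  have iE : i.+1%:R * h = i%:R * h + h by rewrite -natr1 mulrDl mul1r.
  have -> : i.+1%:R * (M * h + c * h ^+ 2) =
      M * h + c * h ^+ 2 + i%:R * (M * h + c * h ^+ 2).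
    by rewrite -natr1 mulrDl mul1r addrC.
  apply: le_trans (opnorm_tri _ (F (i%:R * h)) _) (lerD _ (IH (ltnW ik))).
  rewrite iE -[X in onorm X](subrK (cR h *: F' (i%:R * h))) addrC.
  apply: le_trans (opnormD _ _) _; apply: lerD; last first.
    by apply: H => //; rewrite -iE.
  apply: le_trans (opnormZr _ h0) _; rewrite mulrC ler_wpM2r// HM// ih /=.
  by apply: le_trans ihT; rewrite iE lerDl.
have hk : k%:R * h = T by rewrite /h mulrC divfK// gt_eqF.
have := step k (leqnn k); rewrite hk => Hk; apply: le_trans Hk _.
have -> : k%:R * (M * h + c * h ^+ 2) = M * T + (c * T ^+ 2) / k%:R.
  by rewrite /h; field; rewrite gt_eqF.
rewrite lerD2l.
by rewrite ler_pdivrMr// [e * _]mulrC -ler_pdivrMr// ltW.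
Qed.

Lemma qdiff_lip T F F' : 0 <= T -> qdiff T F F' ->
  exists2 c : R, 0 <= c & forall t h, 0 <= t -> 0 <= h -> t + h <= T ->
    onorm (F (t + h) - F t) <= c * h.
Proof.
move=> T0 [[c c0 H] _ [c' c'0 H']]; exists (c * T + c').
  by rewrite addr_ge0// mulr_ge0.
move=> t h t0 h0 th; rewrite -[X in onorm X](subrK (cR h *: F' t)).
have hT : h <= T by apply: le_trans th; rewrite lerDr.
apply: le_trans (opnormD _ _) _; rewrite mulrDl; apply: lerD.
  apply: le_trans (H _ _ t0 h0 th) _.
  by rewrite -mulrA ler_wpM2l// expr2 ler_wpM2r.
apply: le_trans (opnormZr _ h0) _; rewrite mulrC ler_wpM2r// H'// t0 /=.
by apply: le_trans th; rewrite lerDl.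
Qed.

Lemma bdd_onM T F G : bdd_on T F -> bdd_on T G ->
  bdd_on T (fun t => F t * G t).
Proof.
move=> [c c0 H] [d d0 K]; exists (c * d); first exact: mulr_ge0.
move=> t tT; apply: le_trans (opnormM _ _) _.
by apply: ler_pM => //; [exact: H|exact: K].
Qed.

Lemma bdd_onD T F G : bdd_on T F -> bdd_on T G ->
  bdd_on T (fun t => F t + G t).
Proof.
move=> [c c0 H] [d d0 K]; exists (c + d); first exact: addr_ge0.
by move=> t tT; apply: le_trans (opnormD _ _) _; rewrite lerD ?H ?K.
Qed.

Lemma qdiff_cst T X : qdiff T (fun=> X) (fun=> 0).
Proof.
split; [exists 0 => // t h _ _ _|exists (onorm X) => //|exists 0 => // t _].
  by rewrite subrr scaler0 subr0 opnorm0 mul0r.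
by rewrite opnorm0.
Qed.

Lemma qdiffD T F F' G G' : qdiff T F F' -> qdiff T G G' ->
  qdiff T (fun t => F t + G t) (fun t => F' t + G' t).
Proof.
move=> [[c c0 H] bF bF'] [[d d0 K] bG bG']; split; try exact: bdd_onD.
exists (c + d); first exact: addr_ge0.
move=> t h t0 h0 th; rewrite scalerDr.
have -> : F (t + h) + G (t + h) - (F t + G t) - (cR h *: F' t + cR h *: G' t) =
  (F (t + h) - F t - cR h *: F' t) + (G (t + h) - G t - cR h *: G' t).
  rewrite (opprD (F t)) (opprD (cR h *: _)) (addrACA (F (t + h))).
  by rewrite (addrACA (F (t + h) - F t)).
apply: le_trans (opnormD _ _) _; rewrite mulrDl.
by rewrite lerD ?H ?K.
Qed.

Lemma qdiffM T F F' G G' : 0 <= T -> qdiff T F F' -> qdiff T G G' ->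
  qdiff T (fun t => F t * G t) (fun t => F' t * G t + F t * G' t).
Proof.
move=> T0 dF dG; have [L L0 HL] := qdiff_lip T0 dG.
move: dF dG => [[c c0 H] bF bF'] [[d d0 K] bG bG']; split.
- move: bF bF' bG => [a a0 Ha] [a' a'0 Ha'] [b b0 Hb].
  exists (c * b + a' * L + a * d); first by rewrite !addr_ge0 ?mulr_ge0.
  move=> t h t0 h0 th.
  have -> : F (t + h) * G (t + h) - F t * G t -
      cR h *: (F' t * G t + F t * G' t) =
    (F (t + h) - F t - cR h *: F' t) * G (t + h) +
    (cR h *: F' t) * (G (t + h) - G t) + F t * (G (t + h) - G t - cR h *: G' t).
    rewrite scalerDr !mulrBl !mulrBr -!mulmxE -!scalemxAl -!scalemxAr !mulmxE.
    set x1 := F _ * G _; set x2 := F t * G t; set x3 := F t * G (t + h).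
    set y1 := cR h *: _; set y2 := cR h *: _; set y3 := cR h *: _.
    exact: sub_telescope.
  have tT : 0 <= t <= T by rewrite t0; apply: le_trans th; rewrite lerDl.
  have thT : 0 <= t + h <= T by rewrite addr_ge0.
  have h20 : 0 <= h ^+ 2 by exact: sqr_ge0.
  rewrite [X in _ <= X]mulrDl [X in _ <= X + _]mulrDl.
  apply: le_trans (opnormD _ _) _; apply: lerD.
    apply: le_trans (opnormD _ _) _; apply: lerD.
      apply: le_trans (opnormM _ _) _; rewrite mulrAC.
      by apply: ler_pM; rewrite ?H ?Hb.
    apply: le_trans (opnormM _ _) _.
    have -> : a' * L * h ^+ 2 = (h * a') * (L * h) by ring.
    apply: ler_pM => //; last exact: HL.
    by apply: le_trans (opnormZr _ h0) _; rewrite ler_wpM2l// Ha'.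
  apply: le_trans (opnormM _ _) _; rewrite -mulrA.
  by apply: ler_pM; rewrite ?K ?Ha.
- exact: bdd_onM.
- by apply: bdd_onD; exact: bdd_onM.
Qed.

Lemma eq_qdiff T F F' G G' : F =1 G -> F' =1 G' -> qdiff T F F' -> qdiff T G G'.
Proof. by move=> /funext -> /funext ->. Qed.

Lemma qdiffB T F F' G G' : 0 <= T -> qdiff T F F' -> qdiff T G G' ->
  qdiff T (fun t => F t - G t) (fun t => F' t - G' t).
Proof.
move=> T0 dF dG; have dN := qdiffM T0 (qdiff_cst T (- 1)) dG.
apply: eq_qdiff (qdiffD dF dN) => t; first by rewrite mulN1r.
by rewrite mul0r add0r mulN1r.
Qed.

Lemma qdiff_sum T m (F F' : 'I_m -> R -> 'M[C]_n) :
  (forall i, qdiff T (F i) (F' i)) ->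
  qdiff T (fun t => \sum_(i < m) F i t) (fun t => \sum_(i < m) F' i t).
Proof.
elim: m F F' => [|m IH] F F' H.
  by apply: eq_qdiff (qdiff_cst T 0) => t; rewrite big_ord0.
have dS := IH (fun i => F (widen_ord (leqnSn m) i))
  (fun i => F' (widen_ord (leqnSn m) i)) (fun i => H _).
by apply: eq_qdiff (qdiffD dS (H ord_max)) => t; rewrite big_ord_recr.
Qed.

Lemma qdiff_monomial T k X : 0 <= T ->
  qdiff T (fun t => cR (t ^+ k) *: X) (fun t => cR (k%:R * t ^+ k.-1) *: X).
Proof.
move=> T0; have d1 : qdiff T (fun t => cR t *: (1 : 'M[C]_n)) (fun=> 1).
  split; last by exists (onorm (1 : 'M[C]_n)).
    exists 0 => // t h _ _ _; rewrite -!scalerBl.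
    by rewrite -!cRB -addrA -opprD subrr cR0 scale0r opnorm0 mul0r.
  exists (T * onorm (1 : 'M[C]_n)); first by rewrite mulr_ge0.
  move=> t /andP[t0 tT]; apply: le_trans (opnormZr _ t0) _.
  by rewrite ler_wpM2r.
elim: k => [|k IH].
  by apply: eq_qdiff (qdiff_cst T X) => t; rewrite ?mul0r ?scale0r// expr0 scale1r.
apply: eq_qdiff (qdiffM T0 d1 IH) => t.
  by rewrite -mulmxE -scalemxAl mul1mx scalerA -cRM exprS.
rewrite mul1r -mulmxE -scalemxAl mul1mx scalerA -cRM -scalerDl -cRD.
congr (cR _ *: _); rewrite /= -natr1 mulrDl mul1r addrC; congr (_ + _).
by case: k {IH} => [|k]; rewrite ?mul0r ?mulr0//= mulrCA -exprS.
Qed.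

End QuasiDerivative.

(** * Taylor expansion of the generator of a product of flows *)

Section Flow.
Variable R : realType.
Local Notation C := R[i].
Variable n : nat.
Local Notation M := 'M[C]_n.
Implicit Types (A B X Y : M) (T t h : R) (l : seq M).

Definition skew B := ctrans B = - B.

Definition flow B t : M := mexp (cR t *: B).

Lemma flow0 B : flow B 0 = 1.
Proof. by rewrite /flow cR0 scale0r expm0. Qed.

Lemma flowD B s t : flow B (s + t) = flow B s * flow B t.
Proof.
rewrite /flow cRD scalerDl; apply: expmD; rewrite /GRing.comm.
by rewrite -!mulmxE -!scalemxAl -!scalemxAr !scalerA mulrC.
Qed.

Lemma flowN B t : flow (- B) t = flow B (- t).
Proof. by rewrite /flow cRN scalerN scaleNr. Qed.

Lemma flowK B t : flow B t * flow (- B) t = 1.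
Proof. by rewrite flowN -flowD subrr flow0. Qed.

Lemma flowNK B t : flow (- B) t * flow B t = 1.
Proof. by rewrite flowN -flowD addNr flow0. Qed.

Lemma skewN B : skew B -> skew (- B).
Proof. by rewrite /skew ctransN => ->. Qed.

(** For skew B the adjoint of the flow is the flow of -B, its inverse. *)
Lemma opnorm_flow B t : skew B -> onorm (flow B t) <= 1.
Proof.
move=> sB; apply: isometry_opnorm; rewrite /flow ctrans_expm ctransZ conjc_cR sB.
exact: flowNK.
Qed.

Lemma flow_remainder B h T : 0 <= h -> h <= T ->
  onorm (flow B h - 1 - cR h *: B) <=
    onorm B ^+ 2 * expR (T * onorm B) * h ^+ 2.
Proof.
move=> h0 hT; apply: le_trans (opnorm_expm_sub _) _.
have hB : onorm (cR h *: B) <= h * onorm B by exact: opnormZr.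
have -> : onorm B ^+ 2 * expR (T * onorm B) * h ^+ 2 =
  (h * onorm B) ^+ 2 * expR (T * onorm B) by ring.
apply: ler_pM; rewrite ?exprn_ge0 ?expR_ge0//.
  by rewrite lerXn2r ?nnegrE ?mulr_ge0.
by rewrite ler_expR; apply: le_trans hB _; rewrite ler_wpM2r.
Qed.

Lemma bdd_flow T B : skew B -> bdd_on T (flow B).
Proof. by move=> sB; exists 1 => // t _; exact: opnorm_flow. Qed.

Lemma bdd_cst T X : bdd_on T (fun=> X).
Proof. by exists (onorm X). Qed.

Lemma qdiff_flowl T B : skew B -> qdiff T (flow B) (fun t => B * flow B t).
Proof.
move=> sB; split; [|exact: bdd_flow|exact: (bdd_onM (bdd_cst T B) (bdd_flow T sB))].
exists (onorm B ^+ 2 * expR (T * onorm B)).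
  by rewrite mulr_ge0 ?expR_ge0// exprn_ge0.
move=> t h t0 h0 th.
have hT : h <= T by apply: le_trans th; rewrite lerDr.
have -> : flow B (t + h) - flow B t - cR h *: (B * flow B t) =
    (flow B h - 1 - cR h *: B) * flow B t.
  by rewrite (addrC t h) flowD !mulrBl mul1r -!mulmxE -scalemxAl.
apply: le_trans (flow_remainder B h0 hT).
by apply: opnorm1M; exact: opnorm_flow.
Qed.

(** With B on the right, differentiating [flow B t * X * flow (- B) t] leaves the commutator of B
    and X inside the conjugation. *)
Lemma qdiff_flowr T B : skew B -> qdiff T (flow B) (fun t => flow B t * B).
Proof.
move=> sB; split; [|exact: bdd_flow|exact: (bdd_onM (bdd_flow T sB) (bdd_cst T B))].
exists (onorm B ^+ 2 * expR (T * onorm B)).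
  by rewrite mulr_ge0 ?expR_ge0// exprn_ge0.
move=> t h t0 h0 th.
have hT : h <= T by apply: le_trans th; rewrite lerDr.
have -> : flow B (t + h) - flow B t - cR h *: (flow B t * B) =
    flow B t * (flow B h - 1 - cR h *: B).
  by rewrite flowD !mulrBr mulr1 -!mulmxE -scalemxAr.
apply: le_trans (flow_remainder B h0 hT).
by apply: opnormM1; exact: opnorm_flow.
Qed.

Definition br X Y : M := X * Y - Y * X.

Lemma br0 X : br X 0 = 0.
Proof. by rewrite /br mulr0 mul0r subrr. Qed.

Lemma brD X Y Z : br X (Y + Z) = br X Y + br X Z.
Proof. by rewrite /br mulrDr mulrDl opprD addrACA. Qed.

Lemma brZ X (z : C) Y : br X (z *: Y) = z *: br X Y.
Proof. by rewrite /br -!mulmxE -scalemxAl -scalemxAr -scalerBr. Qed.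

Lemma opnorm_br X Y : onorm (br X Y) <= 2 * onorm X * onorm Y.
Proof.
apply: le_trans (opnormB _ _) _; rewrite -mulrA mulr_natl mulr2n.
by rewrite lerD ?opnormM// mulrC opnormM.
Qed.

(** The derivative of the remainder of order k+1 at X is the remainder of order k at [br B X], so
    induction on k and the mean value inequality suffice. The base case is the isometry of the
    flows. *)
Lemma conj_taylor B X k t : skew B -> 0 <= t ->
  onorm (flow B t * X * flow (- B) t -
    \sum_(s < k) cR (t ^+ s) *: (cR (s`!%:R)^-1 *: iter s (br B) X)) <=
  onorm (iter k (br B) X) * t ^+ k.
Proof.
move=> sB; elim: k X t => [|k IH] X t t0.
  rewrite big_ord0 subr0 expr0 mulr1 /=.
  by rewrite -mulrA; apply: le_trans (opnormM1 _ (opnorm_flow _ sB)) _;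
     apply: opnorm1M; apply: opnorm_flow; exact: skewN.
pose Y s := cR (s`!%:R)^-1 *: iter s (br B) X.
pose F t := flow B t * X * flow (- B) t - \sum_(s < k.+1) cR (t ^+ s) *: Y s.
pose F' t := flow B t * br B X * flow (- B) t -
  \sum_(s < k) cR (t ^+ s) *: (cR (s`!%:R)^-1 *: iter s (br B) (br B X)).
have dF : qdiff t F F'.
  have d1 := qdiffM t0 (qdiffM t0 (qdiff_flowr t sB) (qdiff_cst t X))
    (qdiff_flowl t (skewN sB)).
  have d2 := qdiff_sum (fun s : 'I_k.+1 => qdiff_monomial s (Y s) t0).
  apply: eq_qdiff (qdiffB t0 d1 d2) => u //; rewrite /F'; congr (_ - _).
    rewrite mulr0 addr0 mulNr mulrN /br mulrBr mulrBl !mulrA.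
    by [].
  rewrite big_ord_recl /= mul0r cR0 scale0r add0r; apply: eq_bigr => s _.
  rewrite /Y /bump /= add1n -iterSr !scalerA -!cRM; congr (cR _ *: _).
  rewrite add0n factS natrM invfM mulrA; congr (_ * _).
  by rewrite mulrAC mulfV ?mul1r ?pnatr_eq0.
have F0 : F 0 = 0.
  rewrite /F !flow0 mulr1 mul1r big_ord_recl big1 /=.
    by rewrite addr0 expr0 /Y fact0 invr1 /= !cR1 !scale1r subrr.
  by move=> s _; rewrite expr0n /= cR0 scale0r.
have HF' u : 0 <= u <= t -> onorm (F' u) <= onorm (iter k.+1 (br B) X) * t ^+ k.
  move=> /andP[u0 ut]; rewrite iterSr; apply: le_trans (IH (br B X) u u0) _.
  by rewrite ler_wpM2l// lerXn2r ?nnegrE.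
have [qF _ _] := dF.
by have := qderiv_mvt t0 qF HF'; rewrite F0 subr0 -[leRHS]mulrA -exprSr.
Qed.

(* [gen l] is the logarithmic derivative of the product of the flows of [l]. *)
Fixpoint gen l t : M :=
  if l is B :: l' then B + flow B t * gen l' t * flow (- B) t else 0.

Definition prod_flow l t : M := \prod_(B <- l) flow B t.

(** Taylor coefficients of [gen l] at 0: conjugation by [flow B t] acts as the exponential series of
    t times the commutator with B, and the inner sum is the resulting Cauchy product. *)
Fixpoint gcoef l q : M :=
  if l is B :: l' then (if q == 0%N then B else 0) +
    \sum_(j < q.+1) cR ((q - j)`!%:R)^-1 *: iter (q - j) (br B) (gcoef l' j)
  else 0.

Lemma prod_flow0 l : prod_flow l 0 = 1.
Proof. by rewrite /prod_flow big1// => B _; exact: flow0. Qed.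

Lemma opnorm_prod_flow l t : {in l, forall B, skew B} ->
  onorm (prod_flow l t) <= 1.
Proof.
rewrite /prod_flow; elim: l => [|B l IH] sl; first by rewrite big_nil opnorm1.
rewrite big_cons; apply: le_trans (opnormM1 _ _) _.
  by apply: opnorm_flow; apply: sl; rewrite mem_head.
by apply: IH => X Xl; apply: sl; rewrite in_cons Xl orbT.
Qed.

Lemma qdiff_prod_flow T l : 0 <= T -> {in l, forall B, skew B} ->
  qdiff T (prod_flow l) (fun t => gen l t * prod_flow l t) /\ bdd_on T (gen l).
Proof.
move=> T0; elim: l => [|B l IH] sl.
  split; last exact: bdd_cst.
  by apply: eq_qdiff (qdiff_cst T 1) => t; rewrite ?mul0r// /prod_flow big_nil.
have sB : skew B by apply: sl; rewrite mem_head.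
have [dl bl] : qdiff T (prod_flow l) (fun t => gen l t * prod_flow l t) /\
    bdd_on T (gen l).
  by apply: IH => X Xl; apply: sl; rewrite in_cons Xl orbT.
split.
  apply: eq_qdiff (qdiffM T0 (qdiff_flowl T sB) dl) => t.
    by rewrite /prod_flow big_cons.
  have -> : prod_flow (B :: l) t = flow B t * prod_flow l t.
    by rewrite /prod_flow big_cons.
  rewrite /= mulrDl -mulrA; congr (_ + _).
  by rewrite -!mulrA [flow (- B) t * _]mulrA flowNK mul1r.
apply: bdd_onD; first exact: bdd_cst.
by apply: bdd_onM; [apply: bdd_onM => //; exact: bdd_flow|apply: bdd_flow; exact: skewN].
Qed.

(** Acting on the functional rather than on matrices lets [iter q (adl l) phi X] sum over all q-fold
    commutators around X, while [phi] stays free to vary in inductions. *)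
Definition adl l (phi : M -> R) X : R := \sum_(B <- l) phi (br B X).

(* The sum of [phi] over all (q+1)-fold nested commutators of elements of [l]. *)
Definition nested l q (phi : M -> R) : R := \sum_(B <- l) iter q (adl l) phi B.

Implicit Types phi psi : M -> R.

Lemma adl_ge0 l q phi X : (forall Y, 0 <= phi Y) -> 0 <= iter q (adl l) phi X.
Proof.
move=> phi0; elim: q X => [|q IH] X //=.
by apply: sumr_ge0 => B _; exact: IH.
Qed.

Lemma nested_ge0 l q phi : (forall Y, 0 <= phi Y) -> 0 <= nested l q phi.
Proof. by move=> phi0; apply: sumr_ge0 => B _; exact: adl_ge0. Qed.

Lemma adl_add l q phi psi X :
  iter q (adl l) (fun Y => phi Y + psi Y) X =
  iter q (adl l) phi X + iter q (adl l) psi X.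
Proof.
elim: q X => [|q IH] X //=; rewrite /adl -big_split /=.
by apply: eq_bigr => B _; exact: IH.
Qed.

Lemma adl_cons l q phi B X : (forall Y, 0 <= phi Y) ->
  iter q (adl l) phi X <= iter q (adl (B :: l)) phi X.
Proof.
move=> phi0; elim: q X => [|q IH] X //=; rewrite {1 3}/adl big_cons.
apply: le_trans (_ : adl l (iter q (adl (B :: l)) phi) X <= _).
  by apply: ler_sum => Y _; exact: IH.
by rewrite lerDr adl_ge0.
Qed.

Lemma nested_cons l q phi B : (forall Y, 0 <= phi Y) ->
  nested l q phi <= nested (B :: l) q phi.
Proof.
move=> phi0; rewrite /nested big_cons.
apply: (@le_trans _ _ (\sum_(j <- l) iter q (adl (B :: l)) phi j)).
  by apply: ler_sum => Y _; exact: adl_cons.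
by rewrite lerDr adl_ge0.
Qed.

(* Splitting off the leading factor: in a term of the right-hand side, [B]
   may enter the nested commutator at any position, while on the left it
   fills exactly the outermost ones. *)
Lemma nested_split l q phi B : (forall Y, 0 <= phi Y) ->
  \sum_(j < q.+1) nested l j (fun X => phi (iter (q - j) (br B) X)) +
    phi (iter q (br B) B) <= nested (B :: l) q phi.
Proof.
elim: q phi => [|q IH] phi phi0.
  by rewrite big_ord1 /nested big_cons /= addrC.
rewrite big_ord_recr /= subnn /=.
under eq_bigr => j _ do rewrite (subSn (ltn_ord j : (j <= q)%N)) /=.
rewrite addrAC.
have phi0' Y : 0 <= phi (br B Y) by [].
have adl0 Y : 0 <= adl l phi Y by apply: sumr_ge0.
apply: (@le_trans _ _ (nested (B :: l) q (fun Y => phi (br B Y)) +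
    nested (B :: l) q (adl l phi))).
  apply: lerD; first exact: (IH (fun Y => phi (br B Y))).
  apply: (@le_trans _ _ (nested l q (adl l phi))); last exact: nested_cons.
  by rewrite /nested; apply: ler_sum => Y _; rewrite iterSr.
rewrite /nested -big_split /=; apply: ler_sum => Y _.
rewrite -adl_add -[adl (B :: l) _ Y]/(iter q.+1 (adl (B :: l)) phi Y) iterSr.
rewrite (_ : adl (B :: l) phi = fun Y => phi (br B Y) + adl l phi Y)//.
by apply/funext => Z; rewrite /adl big_cons.
Qed.

(** The induction in [gcoef_le] replaces [phi] by its composition with iterated brackets; these
    properties survive that composition. *)
Definition seminorm phi := [/\ phi 0 = 0, forall X, 0 <= phi X,
  forall X Y, phi (X + Y) <= phi X + phi Y &
  forall x X, 0 <= x -> phi (cR x *: X) <= x * phi X].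

Lemma seminorm_opnorm : seminorm (@onorm R n).
Proof.
split; [exact: opnorm0|exact: opnorm_ge0|exact: opnormD|].
by move=> x X; exact: opnormZr.
Qed.

Lemma seminorm_br phi B s : seminorm phi ->
  seminorm (fun X => phi (iter s (br B) X)).
Proof.
move=> sp; elim: s => [//|s [IH0 IH1 IH2 IH3]].
split=> [|X|X Y|x X x0]; rewrite ?iterSr.
- by rewrite br0.
- exact: IH1.
- by rewrite brD; apply: IH2.
- by rewrite brZ; apply: IH3.
Qed.

Lemma seminorm_sum phi m (F : 'I_m -> M) : seminorm phi ->
  phi (\sum_(i < m) F i) <= \sum_(i < m) phi (F i).
Proof.
move=> [p0 _ pD _]; elim/big_rec2: _ => [|i x y _ H]; first by rewrite p0.
by apply: le_trans (pD _ _) _; rewrite lerD2l.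
Qed.

Lemma invf_fact_le1 k : (k`!%:R)^-1 <= 1 :> R.
Proof. by rewrite invf_le1 ?ltr0n ?fact_gt0// ler1n fact_gt0. Qed.

(** Bound the inverse factorials by 1; the recursion of [gcoef] then matches the left side of
    [nested_split]. *)
Lemma gcoef_le l q phi : seminorm phi -> phi (gcoef l q) <= nested l q phi.
Proof.
elim: l q phi => [|B l IH] q phi sp.
  by case: sp => -> *; rewrite /nested big_nil.
have [p0 p1 pD pZ] := sp.
apply: le_trans (nested_split l q B p1) => /=.
apply: le_trans (pD _ _) _; rewrite addrC; apply: lerD.
  apply: le_trans (seminorm_sum _ sp) _; apply: ler_sum => j _.
  apply: le_trans (pZ _ _ _) _; first by rewrite invr_ge0.
  apply: le_trans (IH j _ (seminorm_br B (q - j) sp)).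
  by rewrite ler_piMl// invf_fact_le1.
by case: q => [|q] /=; rewrite ?p0.
Qed.

(** Conjugation by the leading flow does not enlarge the remainder already obtained for the tail,
    and each tail term of degree j is expanded only to order p - j. Every new remainder thus has
    degree exactly p, and [nested_split] collects them. *)
Lemma gen_taylor l p t : (0 < p)%N -> {in l, forall B, skew B} -> 0 <= t ->
  onorm (gen l t - \sum_(q < p) cR (t ^+ q) *: gcoef l q) <=
  nested l p (@onorm R n) * t ^+ p.
Proof.
move=> p0 + t0; elim: l => [|B l IH] sl.
  rewrite /= big1 ?subr0 ?opnorm0; first by rewrite mulr_ge0 ?exprn_ge0 ?nested_ge0.
  by move=> q _; rewrite scaler0.
have sB : skew B by apply: sl; rewrite mem_head.
have {}IH : onorm (gen l t - \sum_(q < p) cR (t ^+ q) *: gcoef l q) <=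
    nested l p (@onorm R n) * t ^+ p.
  by apply: IH => X Xl; apply: sl; rewrite in_cons Xl orbT.
pose f j i := cR (t ^+ (i + j)) *: (cR (i`!%:R)^-1 *: iter i (br B) (gcoef l j)).
have E1 : \sum_(q < p) cR (t ^+ q) *: gcoef (B :: l) q =
    B + \sum_(j < p) \sum_(i < p - j) f j i.
  rewrite -sum_triangle -(prednK p0) /=.
  under eq_bigr do rewrite scalerDr.
  rewrite big_split /=; congr (_ + _).
    rewrite big_ord_recl big1 ?addr0 /=; first by rewrite expr0 cR1 scale1r.
    by move=> q _; rewrite scaler0.
  apply: eq_bigr => q _; rewrite scaler_sumr; apply: eq_bigr => j _.
  by rewrite /f subnK// -ltnS.
rewrite E1 /= opprD addrACA subrr add0r.
set G := \sum_(q < p) cR (t ^+ q) *: gcoef l q in IH *.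
have -> : flow B t * gen l t * flow (- B) t - \sum_(j < p) \sum_(i < p - j) f j i =
   flow B t * (gen l t - G) * flow (- B) t +
   \sum_(j < p) cR (t ^+ j) *: (flow B t * gcoef l j * flow (- B) t -
     \sum_(i < p - j) cR (t ^+ i) *: (cR (i`!%:R)^-1 *: iter i (br B) (gcoef l j))).
  rewrite mulrBr mulrBl -addrA; congr (_ + _).
  under [in RHS]eq_bigr do rewrite scalerBr.
  have S1 : \sum_(j < p) cR (t ^+ j) *: (flow B t * gcoef l j * flow (- B) t) =
      flow B t * G * flow (- B) t.
    rewrite /G mulr_sumr mulr_suml; apply: eq_bigr => j _.
    by rewrite -!mulmxE -scalemxAr -scalemxAl.
  rewrite sumrB S1 addKr; congr (- _).
  apply: eq_bigr => j _; rewrite scaler_sumr; apply: eq_bigr => i _.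
  by rewrite /f [RHS]scalerA -cRM addnC exprD.
(* The summand j = p of [nested_split], with no outer bracket, pays for the remainder inherited from
   the tail; those with j < p pay for the new ones. *)
have p1 := @opnorm_ge0 R n.
have := nested_split l p B p1; rewrite big_ord_recr /= subnn /= => Hs.
apply: le_trans (opnormD _ _) _.
apply: (@le_trans _ _ (nested l p (@onorm R n) * t ^+ p +
  \sum_(j < p) nested l j (fun X => onorm (iter (p - j) (br B) X)) * t ^+ p)).
  apply: lerD.
    rewrite -mulrA; apply: le_trans (opnormM1 _ (opnorm_flow _ sB)) _.
    by apply: le_trans (opnorm1M _ (opnorm_flow _ (skewN sB))) _.
  apply: le_trans (opnorm_sum _ _ _) _; apply: ler_sum => j _.
  apply: le_trans (opnormZr _ (exprn_ge0 _ t0)) _.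
  have jp : p = (j + (p - j))%N by rewrite subnKC// ltnW.
  rewrite [in X in _ <= _ * X]jp exprD mulrCA ler_wpM2l ?exprn_ge0//.
  apply: le_trans (conj_taylor _ _ sB t0) _; rewrite ler_wpM2r ?exprn_ge0//.
  exact: (gcoef_le l j (seminorm_br B (p - j) seminorm_opnorm)).
rewrite -mulr_suml -mulrDl ler_wpM2r ?exprn_ge0//; apply: le_trans Hs.
by rewrite (addrC (nested _ _ _)) lerDl.
Qed.

End Flow.

(** * Order condition, local error and accumulation over steps *)

Section LocalError.
Variable R : realType.
Local Notation C := R[i].
Variable n : nat.
Local Notation M := 'M[C]_n.
Variables (l : seq M) (K : M) (p : nat).
Hypotheses (p_gt0 : (0 < p)%N) (skl : {in l, forall B, skew B}) (skK : skew K).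
Implicit Types t : R.

Definition order_defect q : M := gcoef l q - (if q == 0%N then K else 0).

(** The interaction picture: its derivative contains only the difference [gen l t - K], between
    isometries. *)
Definition interaction t : M := flow (- K) t * prod_flow l t.

Lemma interaction0 : interaction 0 = 1.
Proof. by rewrite /interaction flow0 prod_flow0 mulr1. Qed.

Lemma qdiff_interaction T : 0 <= T -> qdiff T interaction
  (fun t => flow (- K) t * (gen l t - K) * prod_flow l t).
Proof.
move=> T0; have [dS _] := qdiff_prod_flow T0 skl.
apply: eq_qdiff (qdiffM T0 (qdiff_flowr T (skewN skK)) dS) => t //.
by rewrite mulrBr mulrBl mulrN mulNr addrC !mulrA.
Qed.

Lemma interaction_sub1 t : interaction t - 1 =
  flow (- K) t * (prod_flow l t - flow K t).
Proof. by rewrite mulrBr flowNK. Qed.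

Lemma gen_sub_generator t : gen l t - K =
  \sum_(q < p) cR (t ^+ q) *: order_defect q +
  (gen l t - \sum_(q < p) cR (t ^+ q) *: gcoef l q).
Proof.
have -> : \sum_(q < p) cR (t ^+ q) *: order_defect q =
    \sum_(q < p) cR (t ^+ q) *: gcoef l q - K.
  under eq_bigr do rewrite scalerBr.
  rewrite sumrB; congr (_ - _).
  rewrite -(prednK p_gt0) big_ord_recl big1 ?addr0 /=.
    by rewrite expr0 cR1 scale1r.
  by move=> q _; rewrite scaler0.
by rewrite [RHS]addrC [RHS]addrA subrK.
Qed.

Lemma remainder_bound s : (s < p)%N ->
  (forall q, (q < s)%N -> order_defect q = 0) ->
  exists2 c : R, 0 <= c & forall t, 0 <= t <= 1 ->
  onorm (gen l t - K - cR (t ^+ s) *: order_defect s) <= c * t ^+ s.+1.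
Proof.
move=> sp Hs; exists (\sum_(q < p) onorm (order_defect q) + nested l p (@onorm R n)).
  by apply: addr_ge0; [exact: sumr_ge0|exact: nested_ge0].
move=> t /andP[t0 t1]; rewrite gen_sub_generator addrAC mulrDl.
have tX q : (s < q)%N -> t ^+ q <= t ^+ s.+1.
  by move=> sq; apply: ler_wiXn2l => //; rewrite t0 t1.
apply: le_trans (opnormD _ _) _; apply: lerD; last first.
  apply: le_trans (gen_taylor p_gt0 skl t0) _.
  by rewrite ler_wpM2l ?nested_ge0// tX.
rewrite (bigD1 (Ordinal sp))//= addrAC subrr add0r.
rewrite [X in _ <= X * _](bigD1 (Ordinal sp))//= mulrDl -[leLHS]add0r.
apply: lerD; first by rewrite mulr_ge0 ?exprn_ge0.
apply: le_trans (opnorm_sum _ _ _) _; rewrite mulr_suml.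
apply: ler_sum => q qs; apply: le_trans (opnormZr _ (exprn_ge0 _ t0)) _.
have [lt_qs|le_sq] := ltnP q s; first by rewrite Hs// opnorm0 mulr0 mul0r.
rewrite mulrC ler_wpM2l// tX// ltn_neqAle le_sq andbT eq_sym.
by apply: contraNN qs => /eqP qs; apply/eqP/val_inj.
Qed.

Hypothesis order_cond : exists c delta : R, 0 < delta /\
  forall t, `|t| < delta ->
    onorm (prod_flow l t - flow K t) <= c * `|t| ^+ p.+1.

(** If the lower defects vanish, integrating the derivative gives [interaction t - 1] = t^(s+1)
    Q/(s+1) + O(t^(s+2)), with Q the s-th defect. The order condition makes the left side O(t^(p+1))
    with p >= s+1, so dividing by t^(s+1) yields |Q| = O(t). *)
Lemma order_defect_eq0 s : (s < p)%N -> order_defect s = 0.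
Proof.
have [m] := ubnP s; elim: m s => // m IH s sm sp.
have Hs q : (q < s)%N -> order_defect q = 0.
  by move=> qs; apply: IH; [exact: leq_trans qs sm|exact: ltn_trans sp].
have [c0 [delta [delta0 Hc]]] := order_cond.
have [c1 c10 Hr] := remainder_bound sp Hs.
have [Q QE] : exists Q, Q = order_defect s by exists (order_defect s).
rewrite -QE in Hr *.
pose V t := flow (- K) t; pose S t := prod_flow l t.
have dS T (T0 : 0 <= T) := (qdiff_prod_flow T0 skl).1.
(* The leading term of the derivative carries Q between two isometries that are 1 at time 0;
   removing them costs only O(t). *)
pose Z t := V t * Q * S t.
have [L L0 HL] : exists2 L : R, 0 <= L &
    forall t, 0 <= t <= 1 -> onorm (Z t - Q) <= L * t.
  have d1 := qdiffM ler01 (qdiffM ler01 (qdiff_flowl 1 (skewN skK))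
    (qdiff_cst 1 Q)) (dS _ ler01).
  have [L L0 HL] := qdiff_lip ler01 d1; exists L => // t /andP[t0 t1].
  have := HL 0 t (lexx _) t0; rewrite add0r => /(_ t1).
  by rewrite flow0 prod_flow0 mul1r mulr1.
pose x : R := s.+1%:R.
have x0 : 0 < x by rewrite ltr0n.
(* Subtracting the integrated leading term leaves a derivative of size O(t^(s+1)). *)
pose F t := interaction t - cR (t ^+ s.+1) *: (cR x^-1 *: Q).
have HF t : 0 <= t <= 1 -> onorm (F t - F 0) <= (c1 + L) * t ^+ s.+2.
  move=> /andP[t0 t1].
  have [dF _ _] := qdiffB t0 (qdiff_interaction t0)
    (qdiff_monomial s.+1 (cR x^-1 *: Q) t0).
  apply: le_trans (qderiv_mvt t0 dF (M := (c1 + L) * t ^+ s.+1) _) _; last first.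
    by rewrite -mulrA -exprSr.
  move=> u /andP[u0 ut] /=.
  have u1 : 0 <= u <= 1 by rewrite u0 (le_trans ut).
  have -> : cR (s.+1%:R * u ^+ s) *: (cR x^-1 *: Q) = cR (u ^+ s) *: Q.
    by rewrite scalerA -cRM -[s.+1%:R]/x mulrC mulKf ?gt_eqF.
  have -> : flow (- K) u * (gen l u - K) * prod_flow l u - cR (u ^+ s) *: Q =
    V u * (gen l u - K - cR (u ^+ s) *: Q) * S u + cR (u ^+ s) *: (Z u - Q).
    rewrite -/(V u) -/(S u); move: (gen l u - K) => Y.
    rewrite mulrBr mulrBl scalerBr [RHS]addrA; congr (_ - _).
    by rewrite /Z -!mulmxE -scalemxAr -scalemxAl subrK.
  apply: (@le_trans _ _ ((c1 + L) * u ^+ s.+1)); last first.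
    by rewrite ler_wpM2l ?addr_ge0// lerXn2r ?nnegrE.
  rewrite mulrDl; apply: le_trans (opnormD _ _) _; apply: lerD.
    apply: le_trans (opnorm1M _ (opnorm_prod_flow _ skl)) _.
    apply: le_trans (opnormM1 _ (opnorm_flow _ (skewN skK))) _.
    exact: Hr.
  apply: le_trans (opnormZr _ (exprn_ge0 _ u0)) _.
  by rewrite exprSr mulrCA ler_wpM2l ?exprn_ge0// HL.
have F0 : F 0 = 1.
  by rewrite /F interaction0 expr0n /= cR0 scale0r subr0.
pose D := x * (`|c0| + (c1 + L)).
have D0 : 0 <= D by rewrite mulr_ge0 ?addr_ge0// ltW.
have HQ t : 0 < t -> t <= 1 -> t < delta -> onorm Q <= D * t.
  move=> t0 t1 td; have t0' := ltW t0.
  have Qt : Q = cR (x / t ^+ s.+1) *: ((interaction t - 1) - (F t - F 0)).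
    rewrite F0 /F opprB addrA subrK opprB addrCA subrr addr0.
    rewrite !scalerA -!cRM.
    have -> : x / t ^+ s.+1 * t ^+ s.+1 / x = 1.
      by rewrite divfK ?divff ?gt_eqF// exprn_gt0.
    by rewrite cR1 scale1r.
  rewrite {1}Qt; apply: le_trans (opnormZr _ _) _.
    by rewrite divr_ge0 ?exprn_ge0// ltW.
  have -> : D * t = x / t ^+ s.+1 * ((`|c0| + (c1 + L)) * t ^+ s.+2).
    rewrite /D [t ^+ s.+2]exprSr.
    have := exprn_gt0 s.+1 t0; move: (t ^+ s.+1) (`|c0| + (c1 + L)) => u v u0.
    by field; rewrite gt_eqF.
  rewrite ler_wpM2l ?divr_ge0 ?exprn_ge0 ?(ltW x0)//.
  apply: le_trans (opnormB _ _) _; rewrite mulrDl; apply: lerD; last first.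
    by apply: HF; rewrite t0' t1.
  rewrite interaction_sub1.
  apply: le_trans (opnormM1 _ (opnorm_flow _ (skewN skK))) _.
  have := Hc t; rewrite ger0_norm// => /(_ td) /le_trans; apply.
  apply: (@le_trans _ _ (`|c0| * t ^+ p.+1)).
    by rewrite ler_wpM2r ?exprn_ge0// ler_norm.
  by rewrite ler_wpM2l// ler_wiXn2l// t0' t1.
apply: opnorm_eq0; apply/ler_addgt0Pr => e e0; rewrite add0r.
(* Inside the unit interval and the order radius, and small enough that D t <= e; the +1 covers D =
   0. *)
pose t := Num.min 1 (Num.min (delta / 2) (e / (D + 1))).
have D1 : 0 < D + 1 by rewrite ltr_wpDl.
have t0 : 0 < t by rewrite !lt_min ltr01 !divr_gt0.
apply: le_trans (HQ t t0 _ _) _.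
- by rewrite ge_min lexx.
- have : t <= delta / 2 by rewrite !ge_min lexx orbT.
  by move=> /le_lt_trans; apply; rewrite ltr_pdivrMr// mulr_natr mulr2n ltrDl.
have : t <= e / (D + 1) by rewrite !ge_min lexx !orbT.
rewrite ler_pdivlMr// => /le_trans te.
apply: le_trans (_ : t * (D + 1) <= e); last exact: te.
by rewrite mulrC ler_wpM2l ?(ltW t0)// lerDl.
Qed.

(** With all defects below degree p gone, [gen l t - K] is exactly the remainder of [gen_taylor];
    integration adds one power of t. *)
Lemma local_error t : 0 <= t ->
  onorm (prod_flow l t - flow K t) <= nested l p (@onorm R n) * t ^+ p.+1.
Proof.
move=> t0; have -> : prod_flow l t - flow K t = flow K t * (interaction t - 1).
  by rewrite interaction_sub1 mulrA flowK mul1r.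
apply: le_trans (opnormM1 _ (opnorm_flow _ skK)) _.
have [dW _ _] := qdiff_interaction t0.
rewrite -interaction0 exprSr mulrA; apply: (qderiv_mvt t0 dW) => u /andP[u0 ut].
apply: le_trans (opnorm1M _ (opnorm_prod_flow _ skl)) _.
apply: le_trans (opnormM1 _ (opnorm_flow _ (skewN skK))) _.
rewrite gen_sub_generator big1 ?add0r; last first.
  by move=> q _; rewrite order_defect_eq0// scaler0.
apply: le_trans (gen_taylor p_gt0 skl u0) _.
by rewrite ler_wpM2l ?nested_ge0// lerXn2r ?nnegrE.
Qed.

Lemma flow_natmul t r : flow K t ^+ r = flow K (r%:R * t).
Proof.
elim: r => [|r IH]; first by rewrite expr0 mul0r flow0.
by rewrite exprS IH -flowD -natr1 mulrDl mul1r addrC.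
Qed.

(** Telescoping: both powers are products of isometries, so the local errors simply add. *)
Lemma global_error t r : 0 <= t ->
  onorm (prod_flow l t ^+ r - flow K (r%:R * t)) <=
    r%:R * (nested l p (@onorm R n) * t ^+ p.+1).
Proof.
move=> t0; rewrite -flow_natmul; elim: r => [|r IH].
  by rewrite !expr0 subrr opnorm0 mul0r.
have -> : prod_flow l t ^+ r.+1 - flow K t ^+ r.+1 =
    prod_flow l t * (prod_flow l t ^+ r - flow K t ^+ r) +
    (prod_flow l t - flow K t) * flow K t ^+ r.
  by rewrite !exprS mulrBr mulrBl addrA subrK.
apply: le_trans (opnormD _ _) _.
rewrite -natr1 [leRHS]mulrDl mul1r; apply: lerD.
  by apply: le_trans (opnormM1 _ (opnorm_prod_flow _ skl)) IH.
apply: le_trans (opnorm1M _ _) (local_error t0).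
by rewrite flow_natmul opnorm_flow.
Qed.

End LocalError.

(** * Pauli strings and lattice counting *)

Section Pauli.
Variable R : realType.
Local Notation C := R[i].
Variables N nq : nat.
Implicit Types P Q : PauliString N nq.
Local Notation pm := (@pauli_mx R N nq).

Lemma pauli1_conj (a : 'I_4) x y : conjc (pauli1 R a x y) = pauli1 R a y x.
Proof.
by case: a => [[|[|[|[|m]]]] // Hm]; case: x; case: y;
  apply/eqP; rewrite eq_complex /= ?oppr0 ?opprK !eqxx.
Qed.

Lemma pauli1_sqr (a : 'I_4) x y :
  \sum_(z : bool) pauli1 R a x z * pauli1 R a z y = (x == y)%:R.
Proof.
rewrite big_bool; case: a => [[|[|[|[|m]]]] // Hm]; case: x; case: y;
  by apply/eqP; rewrite eq_complex; apply/andP; split; apply/eqP => /=; ring.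
Qed.

Lemma pauli1_id x y : pauli1 R ord0 x y = (x == y)%:R.
Proof. by rewrite /pauli1 /=; case: (x == y). Qed.

(** Summing over basis functions distributes over the product of qubits, reducing Pauli algebra to 2
    by 2 matrices. *)
Lemma pauli_mulE P Q i j : (pm P * pm Q) i j =
  \prod_q \sum_(z : bool) pauli1 R (P q) ((enum_val i : Basis N nq) q) z *
    pauli1 R (Q q) z ((enum_val j : Basis N nq) q).
Proof.
rewrite mxE bigA_distr_bigA /=.
pose F (f : Basis N nq) := \prod_q (pauli1 R (P q) ((enum_val i : Basis N nq) q) (f q) *
    pauli1 R (Q q) (f q) ((enum_val j : Basis N nq) q)).
transitivity (\sum_(k < Dim N nq) F (enum_val k)).
  by apply: eq_bigr => k _; rewrite !mxE -big_split.
by rewrite -(big_enum_val F); apply: eq_bigl.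
Qed.

Lemma pauli_sqr P : pm P * pm P = 1.
Proof.
apply/matrixP => i j; rewrite pauli_mulE.
under eq_bigr do rewrite pauli1_sqr.
rewrite [RHS]mxE; have [->|ij] := eqVneq i j.
  by rewrite big1// => q _; rewrite eqxx.
have /existsP [q qij] :
    [exists q, (enum_val i : Basis N nq) q != (enum_val j : Basis N nq) q].
  rewrite -negb_forall; apply: contraNN ij => /forallP H.
  by apply/eqP/enum_val_inj/ffunP => q; apply/eqP.
by rewrite (bigD1 q)//= (negbTE qij) mul0r.
Qed.

Lemma opnorm_pauli P : onorm (pm P) <= 1.
Proof.
apply: isometry_opnorm; rewrite -[RHS](pauli_sqr P); congr (_ * _).
apply/matrixP => i j; rewrite ctransE !mxE rmorph_prod.
by apply: eq_bigr => q _; exact: pauli1_conj.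
Qed.

Lemma pauli_comm P Q : (forall q, P q = ord0 \/ Q q = ord0) ->
  pm P * pm Q = pm Q * pm P.
Proof.
move=> H; apply/matrixP => i j; rewrite !pauli_mulE; apply: eq_bigr => q _.
have sum_id (f : bool -> C) x : \sum_(z : bool) (x == z)%:R * f z = f x.
  by rewrite big_bool; case: x; rewrite /= ?mul1r ?mul0r ?addr0 ?add0r.
have [-> | ->] := H q; under eq_bigr do rewrite pauli1_id;
  under [RHS]eq_bigr do rewrite pauli1_id.
  rewrite sum_id; under eq_bigr do rewrite eq_sym mulrC.
  by rewrite sum_id.
rewrite [RHS]sum_id; under eq_bigr do rewrite eq_sym mulrC.
by rewrite sum_id.
Qed.

Variable m : nat.
Variables (c : 'I_m -> C) (P : 'I_m -> PauliString N nq).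

Lemma opnorm_term_mx x : (forall i, cabs (c i) <= x) ->
  onorm (term_mx c P) <= m%:R * x.
Proof.
move=> cx; apply: le_trans (opnorm_sum _ _ _) _.
apply: (@le_trans _ _ (\sum_(i < m) x)).
  apply: ler_sum => i _; apply: le_trans (opnormZ _ _) _.
  by apply: le_trans (cx i); rewrite ler_piMr ?cabs_ge0// opnorm_pauli.
by rewrite sumr_const card_ord mulr_natl.
Qed.

End Pauli.

Lemma term_mx_comm (R : realType) N nq m m' (c : 'I_m -> R[i]) (c' : 'I_m' -> R[i])
    (P : 'I_m -> PauliString N nq) (P' : 'I_m' -> PauliString N nq) :
  (forall i i' q, P i q = ord0 \/ P' i' q = ord0) ->
  br (term_mx c P) (term_mx c' P') = 0.
Proof.
move=> H; apply/eqP; rewrite subr_eq0; apply/eqP.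
rewrite /term_mx [LHS]mulr_suml [RHS]mulr_sumr; apply: eq_bigr => i _.
rewrite [LHS]mulr_sumr [RHS]mulr_suml; apply: eq_bigr => i' _.
rewrite -!mulmxE -!scalemxAl -!scalemxAr !scalerA mulrC; congr (_ *: _).
exact: pauli_comm.
Qed.

Section Lattice.
Variables (N d k : nat) (pos : 'I_N -> 'I_d -> int).
Implicit Types (J : {set 'I_N}) (x y : 'I_N).

Lemma l1dist_triangle (u v w : 'I_d -> int) :
  (l1dist u w <= l1dist u v + l1dist v w)%N.
Proof.
rewrite /l1dist -big_split /=; apply: leq_sum => i _; exact: leqD_dist.
Qed.

Lemma l1dist_path (e : rel 'I_N) x s : path e x s ->
  (forall y z, e y z -> l1dist (pos y) (pos z) = 1%N) ->
  (l1dist (pos x) (pos (last x s)) <= size s)%N.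
Proof.
move=> + e1; elim: s x => [|y s IH] x /=.
  by move=> _; rewrite /l1dist big1// => i _; rewrite subrr.
move=> /andP[exy ps]; apply: leq_trans (l1dist_triangle _ (pos y) _) _.
by rewrite (e1 _ _ exy) add1n ltnS IH.
Qed.

(** A repetition-free path inside J has at most [#|J|] unit steps. *)
Lemma site_connected_dist J x y : site_connected pos J -> x \in J -> y \in J ->
  (l1dist (pos x) (pos y) <= #|J|)%N.
Proof.
move=> /forall_inP Hc xJ yJ; have /forall_inP /(_ y yJ) := Hc x xJ.
move=> /connectP [s0 ps0 ->]; case/shortenP: ps0 => s ps us _.
apply: leq_trans (l1dist_path ps _) _.
  by move=> u v /and3P[_ _ /eqP].
have sJ : {subset s <= mem J}.
  elim: s x ps {us xJ} => [//|z s IH] x /= /andP[/and3P[_ zJ _] ps] w.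
  by rewrite in_cons => /orP[/eqP -> //|]; exact: IH ps w.
rewrite cardE; apply: uniq_leq_size; first by case/andP: us.
by move=> w /sJ wJ; rewrite mem_enum.
Qed.

(** Each coordinate differs from that of x by at most k, so shifting by k embeds the ball in a box
    of side 2k+1. *)
Lemma card_ball x : injective pos ->
  (#|[set y | (l1dist (pos x) (pos y) <= k)%N]| <= (k.*2.+1) ^ d)%N.
Proof.
move=> pos_inj; set B := [set y | _].
pose f y : {ffun 'I_d -> 'I_(k.*2.+1)} :=
  [ffun i => inord (absz (pos y i - pos x i + k%:Z)%R)].
have f_inj : {in B &, injective f}.
  have coord y i : y \in B -> (absz (pos x i - pos y i)%R <= k)%N.
    by rewrite inE; apply: leq_trans; rewrite /l1dist (bigD1 i)//= leq_addr.
  move=> y z yB zB /ffunP fyz; apply: pos_inj; apply/funext => i.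
  have := fyz i; rewrite !ffunE => /(congr1 (@nat_of_ord _)).
  have := coord y i yB; have := coord z i zB => h1 h2.
  by rewrite !inordK; lia.
rewrite -(card_in_imset f_inj); apply: leq_trans (max_card _) _.
by rewrite card_ffun !card_ord.
Qed.

(** Supports containing x are distinct subsets of the ball of radius k around x. *)
Lemma card_incident G (J : 'I_G -> {set 'I_N}) x : injective pos ->
  injective J -> (forall g, #|J g| <= k)%N ->
  (forall g, site_connected pos (J g)) ->
  (#|[set g | x \in J g]| <= 2 ^ ((k.*2.+1) ^ d))%N.
Proof.
move=> pos_inj J_inj Jk Jc.
rewrite -(card_imset _ J_inj).
set B := [set y | (l1dist (pos x) (pos y) <= k)%N].
apply: (@leq_trans #|powerset B|); last first.
  by rewrite card_powerset leq_exp2l// card_ball.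
apply: subset_leq_card; apply/fintype.subsetP => _ /imsetP [g + ->].
rewrite inE => xg; rewrite powersetE; apply/fintype.subsetP => y yg; rewrite inE.
by apply: leq_trans (Jk g); exact: site_connected_dist.
Qed.

End Lattice.

Section Counting.
Variables (N G K : nat) (J : 'I_G -> {set 'I_N}).
Hypothesis JK : forall x, (#|[set g | x \in J g]| <= K)%N.

Lemma sum_card_incident (Z : {set 'I_N}) :
  (\sum_(g < G) #|J g :&: Z| <= #|Z| * K)%N.
Proof.
have E g : #|J g :&: Z| = (\sum_(x in Z) (x \in J g))%N.
  rewrite -sum1_card big_mkcond [RHS]big_mkcond /=; apply: eq_bigr => x _.
  by rewrite inE; case: (x \in J g); case: (x \in Z).
under eq_bigr do rewrite E.
rewrite exchange_big /= -sum_nat_const; apply: leq_sum => x _.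
apply: leq_trans (JK x); rewrite -sum1_card big_mkcond /= [leqRHS]big_mkcond /=.
by apply: leq_sum => g _; rewrite inE; case: (x \in J g).
Qed.

Lemma sum_card_supports : (\sum_(g < G) #|J g| <= N * K)%N.
Proof.
rewrite -[X in (_ <= X * _)%N](card_ord N) -cardsT.
apply: leq_trans (sum_card_incident _).
by apply: leq_sum => g _; rewrite finset.setIT.
Qed.

Lemma card_touching (Z : {set 'I_N}) :
  (#|[set g | ~~ [disjoint J g & Z]]| <= #|Z| * K)%N.
Proof.
apply: leq_trans (sum_card_incident Z).
rewrite -sum1_card big_mkcond /=; apply: leq_sum => g _; rewrite inE.
by rewrite -finset.setI_eq0 -card_gt0; case: #|_|.
Qed.

(** The extra 1 accounts for the empty set, which contains no site and is a support at most once. *)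
Lemma card_supports : injective J -> (G <= N * K + 1)%N.
Proof.
move=> J_inj; apply: (@leq_trans (\sum_(g < G) 1)%N).
  by rewrite sum1_card card_ord.
apply: (@leq_trans (\sum_(g < G) (#|J g| + (#|J g| == 0)))%N).
  apply: leq_sum => g _; by case: #|_|.
rewrite big_split /=; apply: leq_add; first exact: sum_card_supports.
have [g0 Jg0|none] := pickP (fun g => #|J g| == 0)%N.
  rewrite (bigD1 g0)//= Jg0 big1// => g gg0.
  apply/eqP; rewrite eqb0; apply: contraNN gg0 => Jg.
  by apply/eqP/J_inj; rewrite (cards0_eq (eqP Jg)) (cards0_eq (eqP Jg0)).
by rewrite big1// => g _; rewrite none.
Qed.

End Counting.

Lemma eqW (R : numDomainType) (x y : R) : x = y -> x <= y.
Proof. by move=> ->. Qed.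

(** * Locality bound on nested commutators *)

Section NestedCommutators.
Variable R : realType.
Local Notation C := R[i].
Variables (n N G K U k : nat) (J : 'I_G -> {set 'I_N}) (Hs : 'I_G -> 'M[C]_n).
Variables (z : 'I_U -> 'I_G -> C) (l : seq 'M[C]_n) (A Lam : R).
Hypothesis JK : forall x, (#|[set g | x \in J g]%SET| <= K)%N.
Hypothesis Jk : forall g, (#|J g| <= k)%N.
Hypothesis HsLam : forall g, onorm (Hs g) <= Lam.
Hypothesis zA : forall u g, cabs (z u g) <= A.
Hypotheses (A0 : 0 <= A) (Lam0 : 0 <= Lam).
Hypothesis lE : forall phi : 'M[C]_n -> R,
  \sum_(B <- l) phi B = \sum_(u < U) \sum_(g < G) phi (z u g *: Hs g).
Hypothesis Hs_comm : forall g g', [disjoint J g & J g'] -> br (Hs g) (Hs g') = 0.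
Implicit Types (X Y : 'M[C]_n) (Z : {set 'I_N}).

(** Locality expressed by commutation with the terms away from Z; no tensor factorization of X is
    required. *)
Definition supported Z X := forall g, [disjoint J g & Z] -> br (Hs g) X = 0.

Lemma br_eq0 X Y : br X Y = 0 -> X * Y = Y * X.
Proof. by move=> /eqP; rewrite subr_eq0 => /eqP. Qed.

Lemma br_scalel (w : C) X Y : br (w *: X) Y = w *: br X Y.
Proof. by rewrite /br -!mulmxE -scalemxAl -scalemxAr -scalerBr. Qed.

(** A matrix commuting with two others commutes with their bracket. *)
Lemma supported_br Z g (w : C) X : supported Z X ->
  supported (Z :|: J g)%SET (br (w *: Hs g) X).
Proof.
move=> sX g' dg'; rewrite br_scalel brZ.
have /br_eq0 c1 : br (Hs g') X = 0.
  by apply: sX; apply: disjointWr dg'; exact: finset.subsetUl.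
have /br_eq0 c2 : br (Hs g') (Hs g) = 0.
  by apply: Hs_comm; apply: disjointWr dg'; exact: finset.subsetUr.
suff -> : br (Hs g') (br (Hs g) X) = 0 by rewrite scaler0.
rewrite /br mulrBr mulrBl !mulrA c1 c2 -(mulrA X) c2 -!(mulrA (Hs g)) c1.
by rewrite !mulrA subrr.
Qed.

Lemma adl_onorm0 q : iter q (adl l) (@onorm R n) 0 = 0.
Proof.
elim: q => [|q IH] /=; first exact: opnorm0.
by rewrite /adl big1// => B _; rewrite br0 IH.
Qed.

(** Bracket number i meets a support of at most |Z| + i k sites, so at most K times that many terms
    per stage contribute. Each of the U stages repeats this count, and each bracket costs a factor 2
    A Lam. *)
Lemma nested_supported q Z X : supported Z X ->
  iter q (adl l) (@onorm R n) X <=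
  (2 * A * Lam * (U * K)%:R) ^+ q * (\prod_(i < q) (#|Z| + i * k))%N%:R * onorm X.
Proof.
elim: q Z X => [|q IH] Z X sX /=.
  by rewrite big_ord0 expr0 !mul1r.
set cst := 2 * A * Lam * (U * K)%:R in IH *.
have cst0 : 0 <= cst by rewrite !mulr_ge0.
pose Pi := (\prod_(i < q) (#|Z| + i.+1 * k))%N.
pose b := cst ^+ q * Pi%:R * (2 * A * Lam * onorm X).
have b0 : 0 <= b by rewrite !mulr_ge0 ?exprn_ge0.
have term u g : iter q (adl l) (@onorm R n) (br (z u g *: Hs g) X) <=
    b * (~~ [disjoint J g & Z])%:R.
  have [dg|dg] /= := boolP [disjoint J g & Z].
    by rewrite br_scalel (sX _ dg) scaler0 adl_onorm0 mulr0.
  rewrite mulr1; apply: le_trans (IH _ _ (@supported_br _ g (z u g) _ sX)) _.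
  apply: ler_pM; rewrite ?mulr_ge0 ?exprn_ge0//.
    rewrite ler_wpM2l ?exprn_ge0// ler_nat; apply: leq_prod => i _.
    rewrite mulSn addnA leq_add2r; apply: leq_trans (finset.leq_card_setU _ _) _.
    by rewrite leq_add2l.
  apply: le_trans (opnorm_br _ _) _; rewrite ler_wpM2r// -!mulrA ler_wpM2l//.
  by apply: le_trans (opnormZ _ _) _; exact: ler_pM.
rewrite /adl lE.
apply: (@le_trans _ _ (\sum_(u < U) \sum_(g < G) b * (~~ [disjoint J g & Z])%:R)).
  by apply: ler_sum => u _; apply: ler_sum => g _; exact: term.
rewrite sumr_const card_ord -mulr_sumr -natr_sum.
have -> : (\sum_(g < G) ~~ [disjoint J g & Z])%N =
    #|[set g | ~~ [disjoint J g & Z]]%SET|.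
  rewrite -sum1_card [RHS]big_mkcond /=; apply: eq_bigr => g _.
  by rewrite inE; case: [disjoint _ & _].
apply: (@le_trans _ _ (b * (#|Z| * K)%:R *+ U)).
  by rewrite lerMn2r ler_wpM2l ?ler_nat ?orbT// card_touching.
rewrite big_ord_recl mul0n addn0 -[X in _ <= _ * X * _]/((#|Z| * Pi)%N%:R).
rewrite /b exprSr -mulr_natr !natrM /cst natrM.
by apply/eqW; ring.
Qed.

(** The i = 0 factor of the product is kept as [#|J g|] instead of being bounded by k: its sum over
    g is at most N K, which is linear in N even when an empty support is present. This needs at
    least one bracket, whence [p.+1]. *)
Lemma nested_le p : nested l p.+1 (@onorm R n) <=
  ((2 * A * (U * K)%:R) ^+ p.+1 * (\prod_(i < p) (k + i.+1 * k))%N%:R *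
     A * (U * K)%:R) * (N%:R * Lam ^+ p.+2).
Proof.
set cst := 2 * A * Lam * (U * K)%:R.
have cst0 : 0 <= cst by rewrite !mulr_ge0.
pose Pi := (\prod_(i < p) (k + i.+1 * k))%N.
have b0 : 0 <= cst ^+ p.+1 * Pi%:R * (A * Lam) by rewrite !mulr_ge0 ?exprn_ge0.
rewrite /nested lE.
apply: (@le_trans _ _ (\sum_(u < U) \sum_(g < G)
    cst ^+ p.+1 * Pi%:R * (A * Lam) * #|J g|%:R)).
  apply: ler_sum => u _; apply: ler_sum => g _.
  have sg : supported (J g) (z u g *: Hs g).
    by move=> g' dg; rewrite brZ Hs_comm// scaler0.
  apply: le_trans (nested_supported p.+1 sg) _.
  apply: (@le_trans _ _ (cst ^+ p.+1 * (#|J g| * Pi)%N%:R * (A * Lam))); last first.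
    by rewrite natrM; apply/eqW; ring.
  apply: ler_pM; rewrite ?mulr_ge0 ?exprn_ge0//.
    rewrite ler_wpM2l ?exprn_ge0// ler_nat big_ord_recl mul0n addn0 leq_mul2l.
    by apply/orP; right; apply: leq_prod => i _; rewrite leq_add2r.
  by apply: le_trans (opnormZ _ _) _; exact: ler_pM.
rewrite sumr_const card_ord -mulr_sumr -natr_sum.
apply: (@le_trans _ _ (cst ^+ p.+1 * Pi%:R * (A * Lam) * (N * K)%:R *+ U)).
  by rewrite lerMn2r ler_wpM2l ?ler_nat ?orbT// sum_card_supports.
rewrite /cst -mulr_natr !natrM.
have -> : 2 * A * Lam * (U%:R * K%:R) = (2 * A * (U%:R * K%:R)) * Lam by ring.
by rewrite exprMn [Lam ^+ p.+2]exprSr; apply/eqW; ring.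
Qed.

End NestedCommutators.

(** * Scales, circuit size and the final constants *)

Lemma size_flatten_le (T : eqType) (s : seq (seq T)) b :
  (forall x, x \in s -> (size x <= b)%N) -> (size (flatten s) <= size s * b)%N.
Proof.
elim: s => [//|x s IH] H /=; rewrite size_cat mulSn leq_add//.
  by apply: H; exact: mem_head.
by apply: IH => y ys; apply: H; rewrite in_cons ys orbT.
Qed.

Section Scales.
Variable R : realType.
Implicit Types t eps cP : R.

Lemma powR_exprn (a x : R) p : (a `^ x) ^+ p = a `^ (x * p%:R).
Proof. by rewrite -powR_mulrn ?powR_ge0// powRrM. Qed.

Lemma trotter_r_scale_expr p N NP cP t eps : (0 < p)%N -> 0 <= cP -> 0 <= t ->
  0 < eps ->
  trotter_r_scale p N NP cP t eps ^+ p = N%:R * (NP%:R * cP * t) ^+ p.+1 / eps.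
Proof.
move=> p0 cP0 t0 e0; have pn0 : p%:R != 0 :> R by rewrite pnatr_eq0 -lt0n.
rewrite /trotter_r_scale !exprMn exprVn !powR_exprn mulVf// mulrDl mul1r mulVf//.
rewrite !powRr1// ?ltW//; congr (_ * _ / _).
by rewrite natr1 powR_mulrn ?mulr_ge0// !exprMn.
Qed.

(** Reads the gate scale as (gates per term) times (number of terms, of order N) times (number of
    steps). *)
Lemma gate_scaleE p N NP cP t eps : (0 < p)%N -> 0 <= cP -> 0 <= t ->
  gate_scale p N NP cP t eps = NP%:R * (N%:R * trotter_r_scale p N NP cP t eps).
Proof.
move=> p0 cP0 t0; have pn0 : p%:R^-1 != 0 :> R by rewrite invr_neq0// pnatr_eq0 -lt0n.
rewrite /gate_scale /trotter_r_scale.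
have -> : N%:R * NP%:R * cP * t = N%:R * (NP%:R * cP * t) by rewrite !mulrA.
rewrite powRM ?mulr_ge0//.
have -> : (N%:R : R) `^ (1 + p%:R^-1) = N%:R * N%:R `^ p%:R^-1.
  have [->|N0] := eqVneq N 0%N.
    by rewrite mul0r powR0// gt_eqF// ltr_pwDl.
  by rewrite powRD ?powRr1// pnatr_eq0 N0 implybT.
by rewrite !mulrA.
Qed.

End Scales.

Section PaperData.
Variable R : realType.
Local Notation C := R[i].

Lemma ctrans_hermitian n (H : 'M[C]_n) : hermitian_mx H -> ctrans H = H.
Proof.
move=> hH; apply/matrixP => i j; rewrite ctransE hH.
by case: (H _ _) => u v /=; rewrite opprK.
Qed.

Lemma skew_hermitian n (H : 'M[C]_n) (x : R) : ctrans H = H ->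
  skew (- (iC R * cR x) *: H).
Proof.
move=> hH; rewrite /skew ctransZ hH -scaleNr; congr (_ *: _).
by apply/eqP; rewrite eq_complex /=; apply/andP; split; apply/eqP; ring.
Qed.

(** The stage coefficient moves into the generator, so that all factors share the time t. *)
Lemma evol_flow n (H : 'M[C]_n) (t x : R) :
  evol (t * x) H = flow (- (iC R * cR x) *: H) t.
Proof.
have E : - (iC R * cR (t * x)) = cR t * - (iC R * cR x).
  by rewrite cRM mulrN mulrCA.
by rewrite /evol E -scalerA /flow mexp.unlock.
Qed.

Definition stage_list n G U (a : 'I_U -> 'I_G -> R) (sig : 'I_U -> {perm 'I_G})
    (Hs : 'I_G -> 'M[C]_n) : seq 'M[C]_n :=
  [seq - (iC R * cR (a u (sig u g))) *: Hs (sig u g) | u <- enum 'I_U, g <- enum 'I_G].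

Lemma prod_formula_flow n G U (a : 'I_U -> 'I_G -> R) (sig : 'I_U -> {perm 'I_G})
    (Hs : 'I_G -> 'M[C]_n) t :
  prod_formula a sig Hs t = prod_flow (stage_list a sig Hs) t.
Proof.
rewrite /prod_formula /prod_flow /stage_list big_allpairs_dep /=.
rewrite ![index_enum _]unlock -!enumT; apply: eq_bigr => u _.
by apply: eq_bigr => g _; exact: evol_flow.
Qed.

(** The reorderings disappear by reindexing each stage, since nested commutators are summed over all
    elements in any order. *)
Lemma sum_stage_list n G U (a : 'I_U -> 'I_G -> R) (sig : 'I_U -> {perm 'I_G})
    (Hs : 'I_G -> 'M[C]_n) (phi : 'M[C]_n -> R) :
  \sum_(B <- stage_list a sig Hs) phi B =
  \sum_(u < U) \sum_(g < G) phi (- (iC R * cR (a u g)) *: Hs g).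
Proof.
rewrite /stage_list big_allpairs_dep /= big_enum /=.
apply: eq_bigr => u _; rewrite big_enum /=.
by rewrite [RHS](reindex_inj (@perm_inj _ (sig u))).
Qed.

Lemma cabs_le_cPmax G (m : 'I_G -> nat) (c : forall g, 'I_(m g) -> C) g i :
  cabs (c g i) <= cPmax c.
Proof.
apply: (@le_trans _ _ (\big[Num.max/0]_(i < m g) cabs (c g i))).
  exact: le_bigmax.
exact: (@le_bigmax _ _ _ _ (fun g => \big[Num.max/0]_(i < m g) cabs (c g i))).
Qed.

Lemma cPmax_ge0 G (m : 'I_G -> nat) (c : forall g, 'I_(m g) -> C) : 0 <= cPmax c.
Proof. exact: bigmax_ge_id. Qed.

Lemma size_circuit_le N nq G (m : 'I_G -> nat)
    (c : forall g, 'I_(m g) -> C) (P : forall g, 'I_(m g) -> PauliString N nq)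
    U (a : 'I_U -> 'I_G -> R) (sig : 'I_U -> {perm 'I_G})
    Uin (b : forall n, 'I_Uin -> 'I_n -> R) (sigin : forall n, 'I_Uin -> {perm 'I_n})
    (t : R) (r : nat) :
  (size (circuit c P a sig b sigin t r) <= r * (U * G * (Uin * NPmax m)))%N.
Proof.
rewrite /circuit; set gates := flatten _.
apply: leq_trans (size_flatten_le (b := (U * G * (Uin * NPmax m))%N) _) _;
  last by rewrite size_nseq.
move=> _ /nseqP[-> _]; rewrite /gates.
apply: leq_trans (size_flatten_le (b := (Uin * NPmax m)%N) _) _; last first.
  by rewrite size_allpairs !size_enum_ord.
move=> _ /allpairsP[[u g] [_ _ ->]] /=.
apply: leq_trans (size_flatten_le (b := NPmax m) _) _; last first.
  by rewrite size_map size_enum_ord.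
move=> _ /mapP[v _ ->]; rewrite size_map size_enum_ord.
exact: (@leq_bigmax _ (fun g => m g)).
Qed.

End PaperData.

Lemma trotter_r_scale_ge0 (R : realType) p N NP (cP t eps : R) :
  0 <= trotter_r_scale p N NP cP t eps.
Proof. by rewrite divr_ge0 ?mulr_ge0 ?powR_ge0. Qed.

Lemma global_error_scale (R : realType) p N (Cst Lam t eps : R) (r : nat) (nest : R) :
  (0 < r)%N -> 0 <= Cst -> 0 <= t ->
  nest <= Cst * (N%:R * Lam ^+ p.+1) ->
  N%:R * (Lam * t) ^+ p.+1 <= r%:R ^+ p * eps ->
  r%:R * (nest * (t / r%:R) ^+ p.+1) <= Cst * eps.
Proof.
move=> r0 C0 t0 hn hr; have rr : 0 < r%:R :> R by rewrite ltr0n.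
apply: (@le_trans _ _ (r%:R * ((Cst * (N%:R * Lam ^+ p.+1)) * (t / r%:R) ^+ p.+1))).
  by rewrite ler_wpM2l// ler_wpM2r// exprn_ge0// divr_ge0.
have -> : r%:R * ((Cst * (N%:R * Lam ^+ p.+1)) * (t / r%:R) ^+ p.+1) =
    Cst * ((N%:R * (Lam * t) ^+ p.+1) / r%:R ^+ p).
  rewrite exprMn [(Lam * t) ^+ _]exprMn exprVn [r%:R ^+ p.+1]exprS invfM.
  move: (Lam ^+ p.+1) (t ^+ p.+1) (exprn_gt0 p rr) => x y; move: (_ ^+ p) => w w0.
  by field; rewrite !gt_eqF.
by rewrite ler_wpM2l// ler_pdivrMr ?exprn_gt0// [eps * _]mulrC.
Qed.

Theorem theorem3p5
  (R : realType) (d k p U Uin : nat) (A c1 c2 : R) :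
  (0 < p)%N -> 0 < c1 ->
  exists Cst : R, 0 < Cst /\
  forall (N nq : nat) (pos : 'I_N -> 'I_d -> int) (G : nat)
    (J : 'I_G -> {set 'I_N})
    (m : 'I_G -> nat)
    (c : forall g, 'I_(m g) -> R[i])
    (P : forall g, 'I_(m g) -> PauliString N nq)
    (a : 'I_U -> 'I_G -> R) (sig : 'I_U -> {perm 'I_G})
    (b : forall n, 'I_Uin -> 'I_n -> R)
    (sigin : forall n, 'I_Uin -> {perm 'I_n})
    (t eps : R),
    (* geometry: Lambda = pos @ 'I_N is a finite set of sites of Z^d *)
    injective pos ->
    (* S = {J g | g < G} is a set of connected sets of at most k sites *)
    injective J ->
    (forall g, #|J g| <= k)%N ->
    (forall g, site_connected pos (J g)) ->
    (* H_J = sum_i c_i P_i: distinct Pauli strings, nonzero coefficients,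
       acting only on the qubits of the sites in J, Hermitian *)
    (forall g, injective (P g)) ->
    (forall g i, c g i != 0) ->
    (forall g i (q : Qubit N nq), P g i q != ord0 -> q.1 \in J g) ->
    (forall g, hermitian_mx (term_mx (c g) (P g))) ->
    (* outer p-th order product formula over the H_J *)
    coeffs_sum_one a ->
    (forall u g, `|a u g| <= A) ->
    has_order p (fun g => term_mx (c g) (P g))
      (prod_formula a sig (fun g => term_mx (c g) (P g))) ->
    (* inner p-th order product formulas over the Pauli decompositions *)
    (forall n, coeffs_sum_one (b n)) ->
    (forall g, has_order p (pauli_terms (c g) (P g))
        (prod_formula (b (m g)) (sigin (m g)) (pauli_terms (c g) (P g)))) ->
    0 <= t -> 0 < eps ->
    let H := \sum_(g < G) term_mx (c g) (P g) in
    let NP := NPmax m in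
    let cP := cPmax c in
    (forall r : nat, (0 < r)%N ->
       trotter_r_scale p N NP cP t eps <= r%:R ->
       opnorm (prod_formula a sig (fun g => term_mx (c g) (P g)) (t / r%:R) ^+ r
               - evol t H) <= Cst * eps)
    /\
    (forall r : nat,
       c1 * trotter_r_scale p N NP cP t eps <= r%:R <=
         c2 * trotter_r_scale p N NP cP t eps ->
       ((size (circuit c P a sig b sigin t r))%:R : R)
         <= Cst * gate_scale p N NP cP t eps).
Proof.
(* K bounds the supports through one site. Nothing forces A to be nonnegative, hence the maximum. *)
move=> p0 c10; pose K := (2 ^ ((k.*2.+1) ^ d))%N; pose A' := Num.max A 0.
have A'0 : 0 <= A' by rewrite le_max lexx orbT.
(* The factor of [nested_le] at p - 1 that is independent of N and of the term norms. *)
pose CT := (2 * A' * (U * K)%:R) ^+ p *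
  (\prod_(i < p.-1) (k + i.+1 * k))%N%:R * A' * (U * K)%:R.
have CT0 : 0 <= CT by rewrite !mulr_ge0 ?exprn_ge0 ?mulr_ge0.
(* K + 1 comes from G <= N K + 1 <= N (K + 1) for positive N. *)
pose CG := `|c2| * (U * Uin * (K + 1))%N%:R.
have CG0 : 0 <= CG by rewrite mulr_ge0.
exists (CT + CG + 1); split; first by rewrite ltr_wpDl ?addr_ge0.
move=> N nq pos G J m c P a sig b sigin t eps pos_inj J_inj Jk Jc _ _ Psup Hherm.
move=> _ aA Hord _ _ t0 e0 H NP cP.
have cP0 : 0 <= cP by exact: cPmax_ge0.
have JK x : (#|[set g | x \in J g]%SET| <= K)%N by exact: (card_incident (pos := pos)).
have onE n (X : 'M[R[i]]_n) : opnorm X = onorm X by rewrite onorm.unlock.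
split=> [r r0 hr|r /andP[_ hr]].
  pose Hs g : 'M[R[i]]_(Dim N nq) := term_mx (c g) (P g).
  have Hs_adj g : ctrans (Hs g) = Hs g by exact: ctrans_hermitian (Hherm g).
  have H_adj : ctrans H = H.
    rewrite /H (big_morph (@ctrans R _) (@ctransD R _) (ctrans0 R _)).
    by apply: eq_bigr => g _; exact: Hs_adj.
  pose l := stage_list a sig Hs; pose KH := - (iC R * cR 1) *: H.
  have skl : {in l, forall B, skew B}.
    by move=> _ /allpairsP[[u g] [_ _ ->]]; exact: skew_hermitian.
  have skK : skew KH by exact: skew_hermitian.
  have evE s : evol s H = flow KH s by rewrite -evol_flow mulr1.
  have tau0 : 0 <= t / r%:R by rewrite divr_ge0.
  have ord : exists c0 delta : R, 0 < delta /\ forall s, `|s| < delta ->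
      onorm (prod_flow l s - flow KH s) <= c0 * `|s| ^+ p.+1.
    have [c0 [delta [delta0 Hd]]] := Hord; exists c0, delta; split=> // s sd.
    by have := Hd s sd; rewrite onE prod_formula_flow evE.
  rewrite onE prod_formula_flow evE.
  have -> : flow KH t = flow KH (r%:R * (t / r%:R)).
    by rewrite mulrC divfK// pnatr_eq0 -lt0n.
  apply: le_trans (global_error p0 skl skK ord r tau0) _.
  apply: (@le_trans _ _ (CT * eps)); last first.
    apply: ler_wpM2r; first exact: ltW.
    by rewrite -addrA lerDl addr_ge0.
  apply: (@global_error_scale _ _ N _ (NP%:R * cP)) => //.
    have := @nested_le R _ N G K U k J Hs (fun u g => - (iC R * cR (a u g))) l A'
      (NP%:R * cP) JK Jk _ _ A'0 _ (sum_stage_list a sig Hs) _ p.-1.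
    rewrite (prednK p0); apply.
    - move=> g; apply: (@le_trans _ _ ((m g)%:R * cP)).
        by apply: opnorm_term_mx => i; exact: cabs_le_cPmax.
      by rewrite ler_wpM2r// ler_nat; exact: (@leq_bigmax _ (fun g => m g)).
    - move=> u g; rewrite cabsN cabsM cabs_iC mul1r cabs_cR.
      by rewrite le_max aA.
    - by rewrite mulr_ge0.
    move=> g g' dg; apply: term_mx_comm => i i' q.
    have [P0|/Psup qJ] := eqVneq (P g i q) ord0; first by left.
    have [P0|/Psup qJ'] := eqVneq (P g' i' q) ord0; first by right.
    by move/pred0P: dg => /(_ q.1) /=; rewrite qJ qJ'.
  (* The requirement on r is the p-th power of the assumed lower bound on r. *)
  rewrite -ler_pdivrMr// -trotter_r_scale_expr//.
  by rewrite lerXn2r ?nnegrE// trotter_r_scale_ge0.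
have r_le : r%:R <= `|c2| * trotter_r_scale p N NP cP t eps.
  by apply: le_trans hr _; rewrite ler_wpM2r ?trotter_r_scale_ge0// ler_norm.
have rG : (r * G <= r * (N * (K + 1)))%N.
  have GK := card_supports JK J_inj.
  (* On an empty lattice G may still be 1, but then the step scale is 0 and forces r = 0. *)
  have [N0|N0] := posnP N; last first.
    by rewrite leq_mul2l; apply/orP; right; apply: leq_trans GK _;
    rewrite mulnDr muln1 leq_add2l.
  suff -> : r = 0%N by [].
  apply/eqP; rewrite -(lern0 R).
  apply: le_trans r_le _; rewrite /trotter_r_scale N0 powR0 ?mul0r ?mulr0//.
  by rewrite invr_neq0// pnatr_eq0 -lt0n.
apply: (@le_trans _ _ (CG * gate_scale p N NP cP t eps)); last first.
  apply: ler_wpM2r; last by rewrite addrAC lerDr addr_ge0.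
  rewrite gate_scaleE//; apply: mulr_ge0 => //; apply: mulr_ge0 => //.
  exact: trotter_r_scale_ge0.
apply: (@le_trans _ _ ((r * (N * (K + 1)) * (U * (Uin * NP)))%N%:R)).
  rewrite ler_nat; apply: leq_trans (size_circuit_le _ _ _ _ _ _ _ _) _.
  rewrite -/NP (_ : r * (U * G * (Uin * NP)) = r * G * (U * (Uin * NP)))%N; last first.
    by rewrite [(U * G)%N]mulnC !mulnA.
  by rewrite leq_mul2r rG orbT.
rewrite gate_scaleE// /CG.
apply: (@le_trans _ _ ((`|c2| * trotter_r_scale p N NP cP t eps) *
    ((N * (K + 1)) * (U * (Uin * NP)))%N%:R)).
  by rewrite -mulnA natrM ler_wpM2r.
by apply/eqW; rewrite !natrM; ring.
Qed.
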